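(* Let $n=1$, let $q>0$, and let $v:\mathbb{T}^1\to\mathbb{R}$ be Lipschitz continuous and nonnegative. For $P\in\mathbb{R}$ and $\alpha\ge 0$ let $\bar H(P,\alpha)$ be the unique constant for which the system $$\begin{cases} -u''+\frac{|u'+P|^2}{2}-v(y)-\alpha^q m^q=\bar H(P,\alpha), & y\in\mathbb{T}^1,\\ -m''-\big(m(u'+P)\big)'=0, & y\in\mathbb{T}^1,\\ \int_{\mathbb{T}^1}u\,dy=0,\quad \int_{\mathbb{T}^1}m\,dy=1\end{cases}$$ admits a solution, let $(u,m)$ be its unique solution, and let $\bar b(P,\alpha)=\int_{\mathbb{T}^1}(u'+P)\,m\,dy$. Then $$\nabla_P\bar H(P,\alpha)\ne\bar b(P,\alpha),$$ in the sense that $\nabla_P\bar H$ and $\bar b$ do not coincide, i.e. the two differ at some $(P,\alpha)$.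
   Context: $\mathbb{T}^1=\mathbb{R}/\mathbb{Z}$ is the unit flat torus; functions on $\mathbb{T}^1$ are identified with $1$-periodic functions on $\mathbb{R}$. $\nabla_P$ is the derivative with respect to $P$. The maps $\bar H$ and $\bar b$ are defined for all $P\in\mathbb{R}$ and $\alpha\ge 0$. Solutions $(u,m)$ of the system are understood as regular solutions, i.e. $(u,m)\in C^{2,\gamma}(\mathbb{T}^1)\times W^{1,p}(\mathbb{T}^1)$ for all $\gamma\in(0,1)$ and all $p>1$, with $m\ge0$, the second equation being understood in the weak (distributional) sense. It is known that for every $P\in\mathbb{R}$ and $\alpha\ge0$ there is exactly one constant $\bar H(P,\alpha)$ for which the system has a solution, and that this solution is unique and satisfies $m>0$.
   Formalization: The potential v is additionally assumed not to be constant; for constant v = c the solution is u = 0, m = 1, and the gradient of the effective Hamiltonian equals P, which equals the effective drift for all P and α, so the claim fails there. *)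

(* Defs.v *)
From HB Require Import structures.
From mathcomp Require Import all_boot all_order all_algebra.
From mathcomp Require Import all_classical all_reals all_analysis.

Set Implicit Arguments.
Unset Strict Implicit.
Unset Printing Implicit Defensive.
Import Order.TTheory GRing.Theory Num.Theory.
Import numFieldNormedType.Exports.
Local Open Scope classical_set_scope.
Local Open Scope ring_scope.

(* Functions on the torus R/Z are 1-periodic functions on the line, and
   integrals over the torus are Lebesgue integrals over [0, 1]. *)

Definition torus_integral (R : realType) (f : R -> R) : R :=
  \int[lebesgue_measure]_(x in `[0%R, 1%R]) f x.

Definition torus_measure (R : realType) :
    {measure set (measurableTypeR R) -> \bar R} :=
  mrestr (@lebesgue_measure R) (measurable_itv `[0 : R, 1]).

(* Test functions: C^infty(T^1). *)
Definition torus_smooth (R : realType) (phi : R -> R) : Prop :=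
  periodic phi 1 /\ forall (n : nat) (x : R), derivable (derive1n n phi) x 1.

(* C^{2,gamma}(T^1); for a 1-periodic function, Hoelder continuity for the
   distance of the torus and for that of the line are the same. *)
Definition torus_C2 (R : realType) (gamma : R) (u : R -> R) : Prop :=
  [/\ periodic u 1,
      forall x, derivable u x 1,
      forall x, derivable (derive1 u) x 1 &
      exists K : R, forall x y,
        `|derive1n 2 u x - derive1n 2 u y| <= K * `|x - y| `^ gamma].

Definition torus_Lp (R : realType) (p : R) (f : R -> R) : Prop :=
  periodic f 1 /\ f \in Lfun (torus_measure R) p%:E.

(* W^{1,p}(T^1): f and its weak derivative g are in L^p. *)
Definition torus_W1p (R : realType) (p : R) (f : R -> R) : Prop :=
  torus_Lp p f /\
  exists g : R -> R, torus_Lp p g /\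
    forall phi, torus_smooth phi ->
      torus_integral (fun y => f y * derive1 phi y) =
      - torus_integral (fun y => g y * phi y).

(* (u, m) is a regular solution of the cell system with parameters P, alpha
   and constant c. The first equation holds at every point, so m is a genuine
   function and not a class modulo null sets. The second one,
   -m'' - (m (u' + P))' = 0, is tested against smooth functions. *)
Definition cell_solution (R : realType) (q : R) (v : R -> R) (P alpha c : R)
    (u m : R -> R) : Prop :=
  [/\ (forall gamma, 0 < gamma < 1 -> torus_C2 gamma u),
      ((forall p, 1 < p -> torus_W1p p m) /\ forall y, 0 <= m y),
      (forall y, - derive1n 2 u y + `|derive1 u y + P| ^+ 2 / 2 - v y
                 - alpha `^ q * m y `^ q = c),
      (forall phi, torus_smooth phi ->
         torus_integral (fun y => - (m y * derive1n 2 phi y)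
                                  + m y * (derive1 u y + P) * derive1 phi y) = 0) &
      torus_integral u = 0 /\ torus_integral m = 1].

(* The equivalence says both that the system is solvable for Hbar P alpha and
   that no other constant works. *)
Definition effective_hamiltonian (R : realType) (q : R) (v : R -> R)
    (Hbar : R -> R -> R) : Prop :=
  forall P alpha, 0 <= alpha ->
  forall c, (exists u m, cell_solution q v P alpha c u m) <-> c = Hbar P alpha.

(* The solution (u, m) is unique, so it does not matter which one is used. *)
Definition effective_drift (R : realType) (q : R) (v : R -> R)
    (Hbar bbar : R -> R -> R) : Prop :=
  forall P alpha, 0 <= alpha ->
  forall u m, cell_solution q v P alpha (Hbar P alpha) u m ->
    bbar P alpha = torus_integral (fun y => (derive1 u y + P) * m y).

(* Main.v *)
Require Import Defs.
From HB Require Import structures.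
From mathcomp Require Import all_boot all_order all_algebra.
From mathcomp Require Import all_classical all_reals all_analysis.
From mathcomp Require Import ring lra.
Set Implicit Arguments.
Unset Strict Implicit.
Unset Printing Implicit Defensive.
Import Order.TTheory GRing.Theory Num.Theory.
Import numFieldNormedType.Exports.
Local Open Scope classical_set_scope.
Local Open Scope ring_scope.

(** The comparison is made at [alpha = 1].  In dimension one the second
equation says that the flux [m' + m (u' + P)] is a constant, and its mean is
[bbar]; with [p := u' + P] the cell system becomes the first order system
[p' = p^2/2 - v - m^q - Hbar], [m' = bbar - m p] on [0, 1], with periodic
boundary values, mean [P] for [p] and mean 1 for [m].

Let [G P] be the integral of [m^(q+1)] for the parameter [P].  Testing the
difference of the first equations for [P1] and [P2] with the density [m2], and
using that [m2' + m2 p2] is constant, gives [cross_identity].  Young's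
inequality turns it into [corrected_subgradient]: [bbar P2] is a subgradient
at [P2] of [K := Hbar + q/(q+1) G].  Adding the identity to its mirror image
gives the monotonicity formula [cross_sum], which controls [p1 - p2] and
[m1 - m2] in L^2 by [(bbar P1 - bbar P2) (P1 - P2)].  As that difference of
drifts is in turn controlled by the two L^2 norms, [bbar] and [G] are locally
Lipschitz in [P] ([flux_lipschitz]).  Hence [K] is differentiable with
[K' = bbar], that is, [Hbar' = bbar - q/(q+1) G'] wherever one of the two
derivatives exists.

Suppose that [Hbar' = bbar] wherever [Hbar] is differentiable.  Then [G' = 0]
wherever [G] is differentiable, and since a Lipschitz function is the integral
of its almost everywhere defined derivative, [G] is constant
([lipschitz_derive0_cst]).  But the energy and density bounds hold uniformly in
[P] and the transport term flattens [m] as [P] grows, so that [G] tends to 1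
at infinity ([coupling_energy_cvg1]).  Thus [G = 1] everywhere.  By the
equality case of Young's inequality [m = 1]; then [p] is constant, and so is
[v] ([coupling_energy_eq1]), against the hypothesis. *)

(** * Integration of continuous functions on the unit interval *)

Definition C0 (R : realType) (f : R -> R) : Prop :=
  {within `[0 : R, 1], continuous f}.

Section Continuity.
Context {R : realType}.
Implicit Types f g : R -> R.

Lemma C0_continuous f : continuous f -> C0 f.
Proof. exact: continuous_subspaceT. Qed.

Lemma C0_cst c : C0 (fun _ : R => c).
Proof. by apply: C0_continuous => x; exact: cvg_cst. Qed.

Lemma C0D f g : C0 f -> C0 g -> C0 (fun y => f y + g y).
Proof. by move=> cf cg x; apply: cvgD; [exact: cf|exact: cg]. Qed.

Lemma C0N f : C0 f -> C0 (fun y => - f y).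
Proof. by move=> cf x; apply: cvgN; exact: cf. Qed.

Lemma C0B f g : C0 f -> C0 g -> C0 (fun y => f y - g y).
Proof. by move=> cf cg; apply: C0D => //; exact: C0N. Qed.

Lemma C0M f g : C0 f -> C0 g -> C0 (fun y => f y * g y).
Proof. by move=> cf cg x; apply: cvgM; [exact: cf|exact: cg]. Qed.

Lemma C0X f n : C0 f -> C0 (fun y => f y ^+ n).
Proof.
move=> cf; elim: n => [|n ih]; first exact: C0_cst.
by rewrite (_ : (fun y => _) = fun y => f y * f y ^+ n);
  [exact: C0M|apply/funext => y; rewrite exprS].
Qed.

Lemma C0_norm f : C0 f -> C0 (fun y => `|f y|).
Proof. by move=> cf x; apply: cvg_norm; exact: cf. Qed.

Lemma C0_id : C0 (id : R -> R).
Proof. by apply: C0_continuous => x; exact: cvg_id. Qed.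

End Continuity.

(** Works on the syntax of the integrand: unification up to conversion against
the closure lemmas would unfold the cosine and the power functions. *)
Ltac c0 := repeat first [ assumption | lazymatch goal with
  | |- C0 (fun _ => ?c) => exact: (@C0_cst _ c)
  | |- C0 (fun y => y) => exact: C0_id
  | |- C0 (fun y => @?f y + @?g y) => apply: (@C0D _ f g)
  | |- C0 (fun y => - @?f y) => apply: (@C0N _ f)
  | |- C0 (fun y => @?f y * @?g y) => apply: (@C0M _ f g)
  | |- C0 (fun y => @?f y ^+ ?n) => apply: (@C0X _ f n)
  | |- C0 (fun y => `|@?f y|) => apply: (@C0_norm _ f)
  end | match goal with H : forall _, C0 _ |- _ => exact: H end ].

Section TorusIntegral.
Context {R : realType}.
Implicit Types f g : R -> R.
Local Notation I := (@torus_integral R).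

Lemma C0_integrable f : C0 f ->
  (@lebesgue_measure R).-integrable `[0, 1] (EFin \o f).
Proof.
by move=> cf; apply: continuous_compact_integrable => //; exact: segment_compact.
Qed.

Lemma eq_torus_integral f g : (forall y : R, 0 <= y <= 1 -> f y = g y) -> I f = I g.
Proof.
move=> fg; apply: eq_Rintegral => y; rewrite inE /= in_itv /=; exact: fg.
Qed.

Lemma torus_integralD f g : C0 f -> C0 g -> I (fun y => f y + g y) = I f + I g.
Proof.
by move=> cf cg; rewrite /torus_integral RintegralD//; exact: C0_integrable.
Qed.

Lemma torus_integralZ c f : C0 f -> I (fun y => c * f y) = c * I f.
Proof.
by move=> cf; rewrite /torus_integral RintegralZl//; exact: C0_integrable.
Qed.

Lemma torus_integralB f g : C0 f -> C0 g -> I (fun y => f y - g y) = I f - I g.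
Proof.
by move=> cf cg; rewrite /torus_integral RintegralB//; exact: C0_integrable.
Qed.

Lemma torus_integral_cst c : I (fun=> c) = c.
Proof.
rewrite /torus_integral Rintegral_cst//= lebesgue_measure_itv/= lte_fin ltr01.
by rewrite -EFinB /= subr0 mulr1.
Qed.

Lemma le_torus_integral f g : C0 f -> C0 g -> (forall y : R, 0 <= y <= 1 -> f y <= g y) ->
  I f <= I g.
Proof.
by move=> cf cg fg; apply: le_Rintegral => //; exact: C0_integrable.
Qed.

Lemma torus_integral_ge0 f : (forall y : R, 0 <= y <= 1 -> 0 <= f y) -> 0 <= I f.
Proof.
by move=> f0; apply: Rintegral_ge0 => y /=; rewrite in_itv /=; exact: f0.
Qed.

Lemma torus_integral_deriv f F : C0 f -> C0 F ->
  (forall y : R, 0 < y < 1 -> is_derive y 1 F (f y)) -> I f = F 1 - F 0.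
Proof.
move=> cf cF dF; rewrite /torus_integral /Rintegral.
rewrite (@continuous_FTC2 _ f F 0 1)//.
- have /(continuous_within_itvP _ ltr01)[cFo cF0 cF1] := cF.
  split => //.
  by move=> x; rewrite in_itv /= => /dF[].
- by move=> x; rewrite in_itv /= => /dF ?; rewrite derive1E derive_val.
Qed.

Lemma nondecreasing_of_deriv f F : C0 F ->
  (forall y : R, 0 < y < 1 -> is_derive y 1 F (f y)) ->
  (forall y : R, 0 < y < 1 -> 0 <= f y) ->
  forall x y : R, 0 <= x -> x <= y -> y <= 1 -> F x <= F y.
Proof.
move=> cF dF f0; apply: ger0_derive1_ndecr => //.
- by move=> x; rewrite in_itv /= => /dF[].
- move=> x; rewrite in_itv /= => x01; have := dF _ x01 => ?.
  by rewrite derive1E derive_val; exact: f0.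
Qed.

Lemma C0_antiderivative f : C0 f -> exists F, C0 F /\
  forall y : R, 0 < y < 1 -> is_derive y 1 F (f y).
Proof.
move=> cf; exists (fun x => \int[lebesgue_measure]_(t in `[0, x]) f t); split.
  by apply: parameterized_integral_continuous => //; exact: C0_integrable.
move=> y /andP[y0 y1].
have cfy : {for y, continuous f}.
  have /(continuous_within_itvP _ ltr01)[cfo _ _] := cf.
  by apply: cfo; rewrite in_itv /= y0.
have [d1 d2] := continuous_FTC1_closed y1 (C0_integrable cf) y0 cfy.
by rewrite -d2 derive1E; apply/derivableP.
Qed.

Lemma near_oo (a b y : R) : a < y < b -> \forall z \near y, a < z < b.
Proof.
move=> y01; have : y \in `]a, b[ by rewrite in_itv.
by move=> /near_in_itvoo; apply: filterS => z; rewrite in_itv.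
Qed.

(** An antiderivative of [f] is nondecreasing with equal end values, so it is
constant and its derivative vanishes. *)
Lemma torus_integral_eq0 f : C0 f -> (forall y : R, 0 <= y <= 1 -> 0 <= f y) -> I f = 0 ->
  forall y : R, 0 < y < 1 -> f y = 0.
Proof.
move=> cf f0 If0 y y01; have [F [cF dF]] := C0_antiderivative cf.
have F10 : F 1 = F 0.
  by apply/eqP; rewrite -subr_eq0 -(torus_integral_deriv cf cF dF) If0.
have ndF := nondecreasing_of_deriv cF dF.
have Fc z : 0 < z < 1 -> F z = F 0.
  move=> /andP[z0 z1]; apply/eqP; rewrite eq_le.
  have {}ndF : forall x y : R, 0 <= x -> x <= y -> y <= 1 -> F x <= F y.
    by apply: ndF => t /andP[t0 t1]; rewrite f0// !ltW.
  by apply/andP; split; [rewrite -F10|]; apply: ndF => //; exact: ltW.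
have d1 := dF _ y01.
have d2 : is_derive y 1 (fun=> F 0) (f y).
  apply: near_eq_is_derive d1; near=> z; apply: Fc.
  by near: z; exact: near_oo.
by have := @derive_val _ _ _ _ _ _ _ d2; rewrite derive_cst.
Unshelve. all: by end_near. Qed.

(** The variance of [f] is nonnegative. *)
Lemma sqr_torus_integral_le f : C0 f -> I f ^+ 2 <= I (fun y => f y ^+ 2).
Proof.
move=> cf.
have : 0 <= I (fun y => f y ^+ 2 - (2 * I f) * f y + I f ^+ 2).
  apply: torus_integral_ge0 => y _.
  rewrite (_ : _ + _ = (f y - I f) ^+ 2); last by ring.
  exact: sqr_ge0.
by rewrite torus_integralD ?torus_integralB ?torus_integralZ ?torus_integral_cst; [move=> ?; lra|c0..].
Qed.

(** If [A] is an antiderivative of [`|g|], then [A - f] and [A + f] are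
nondecreasing, so [f] oscillates by at most [A 1 - A 0]; averaging over the
second point replaces its value by the mean. *)
Lemma dist_mean_le f g : C0 f -> C0 g ->
  (forall y : R, 0 < y < 1 -> is_derive y 1 f (g y)) ->
  forall x : R, 0 <= x <= 1 -> `|f x - I f| <= I (fun y => `|g y|).
Proof.
move=> cf cg df; have [A [cA dA]] := C0_antiderivative (C0_norm cg).
rewrite (torus_integral_deriv (C0_norm cg) cA dA).
have A_nd : forall x y : R, 0 <= x -> x <= y -> y <= 1 -> A x <= A y.
  by apply: (nondecreasing_of_deriv cA dA) => y _; exact: normr_ge0.
have fA1 : forall x y : R, 0 <= x -> x <= y -> y <= 1 -> A x - f x <= A y - f y.
  apply: (@nondecreasing_of_deriv (fun y => `|g y| - g y)) => //.
  - exact: C0B.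
  - by move=> y y01; have := dA _ y01; have := df _ y01 => ? ?; exact: is_deriveB.
  - by move=> y _; rewrite subr_ge0 ler_norm.
have fA2 : forall x y : R, 0 <= x -> x <= y -> y <= 1 -> A x + f x <= A y + f y.
  apply: (@nondecreasing_of_deriv (fun y => `|g y| + g y)) => //.
  - exact: C0D.
  - by move=> y y01; have := dA _ y01; have := df _ y01 => ? ?; exact: is_deriveD.
  - by move=> y _; rewrite -lerBlDr sub0r -normrN ler_norm.
have key x y : 0 <= x <= 1 -> 0 <= y <= 1 -> f x - f y <= A 1 - A 0.
  move=> /andP[x0 x1] /andP[y0 y1].
  have a1 := A_nd 0 _ (lexx 0) x0 x1; have a2 := A_nd _ 1 x0 x1 (lexx 1).
  have a3 := A_nd 0 _ (lexx 0) y0 y1; have a4 := A_nd _ 1 y0 y1 (lexx 1).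
  have [xy|/ltW yx] := leP x y.
    by have := fA2 _ _ x0 xy y1; lra.
  by have := fA1 _ _ y0 yx x1; lra.
move=> x x01.
have cc c : C0 (fun=> c : R) by exact: C0_cst.
rewrite ler_norml; apply/andP; split.
- have : I (fun y => f y - f x) <= I (fun=> A 1 - A 0).
    by apply: le_torus_integral => //; [exact: C0B|move=> y y01; exact: key].
  by rewrite torus_integralB// !torus_integral_cst; lra.
- have : I (fun y => f x - f y) <= I (fun=> A 1 - A 0).
    by apply: le_torus_integral => //; [exact: C0B|move=> y y01; exact: key].
  by rewrite torus_integralB// !torus_integral_cst.
Qed.

End TorusIntegral.

(** * Recovering a constant from its Fourier coefficients *)

Section DuBoisReymond.
Context {R : realType}.
Implicit Types f g : R -> R.
Local Notation I := (@torus_integral R).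

Lemma is_derive_cos_affine (w t y : R) :
  is_derive y 1 (fun y => cos (w * y + t)) (- w * sin (w * y + t)).
Proof.
have h : is_derive y 1 (fun y : R => w * y + t) w.
  have : is_derive y 1 (fun y : R => w * y + t) (w *: 1 + 0).
    by apply: is_deriveD.
  by move=> ?; apply: is_derive_eq; rewrite addr0 [LHS]mulr1.
have := is_derive1_comp (g := fun y : R => w * y + t) (is_derive_cos (w * y + t)) h.
by rewrite mulrC mulrN -mulNr.
Qed.

Lemma is_derive_sin_affine (w t y : R) :
  is_derive y 1 (fun y => sin (w * y + t)) (w * cos (w * y + t)).
Proof.
have h : is_derive y 1 (fun y : R => w * y + t) w.
  have : is_derive y 1 (fun y : R => w * y + t) (w *: 1 + 0).
    by apply: is_deriveD.
  by move=> ?; apply: is_derive_eq; rewrite addr0 [LHS]mulr1.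
by have := is_derive1_comp (g := fun y : R => w * y + t) (is_derive_sin (w * y + t)) h; rewrite mulrC.
Qed.

Lemma C0_cos_affine (w t : R) : C0 (fun y => cos (w * y + t)).
Proof.
apply: C0_continuous => y; apply: differentiable_continuous.
by apply/derivable1_diffP; have [] := is_derive_cos_affine w t y.
Qed.

Lemma C0_sin_affine (w t : R) : C0 (fun y => sin (w * y + t)).
Proof.
apply: C0_continuous => y; apply: differentiable_continuous.
by apply/derivable1_diffP; have [] := is_derive_sin_affine w t y.
Qed.

Lemma cosD2pin (x : R) (k : nat) : cos (x + 2 * pi * k%:R) = cos x.
Proof.
elim: k => [|k ih]; first by rewrite mulr0 addr0.
rewrite -[RHS]ih -(cosD2pi (x + 2 * pi * k%:R)); congr cos.
by rewrite -natr1 mulr2n; ring.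
Qed.

Lemma sinD2pin (x : R) (k : nat) : sin (x + 2 * pi * k%:R) = sin x.
Proof. by rewrite -!cosBpihalf addrAC cosD2pin. Qed.

Lemma torus_integral_cos (k : nat) (t : R) :
  I (fun y => cos (2 * pi * k.+1%:R * y + t)) = 0.
Proof.
set w := 2 * pi * k.+1%:R.
have w0 : w != 0 by rewrite !mulf_neq0// ?pnatr_eq0// gt_eqF// pi_gt0.
apply: (mulfI w0); rewrite mulr0 -torus_integralZ; last exact: C0_cos_affine.
have dsin (y : R) : 0 < y < 1 ->
    is_derive y 1 (fun y => sin (w * y + t)) (w * cos (w * y + t)).
  by move=> _; exact: is_derive_sin_affine.
have cw : C0 (fun y => w * cos (w * y + t)).
  by apply: C0M; [exact: C0_cst|exact: C0_cos_affine].
have cs : C0 (fun y => sin (w * y + t)) by exact: C0_sin_affine.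
rewrite (torus_integral_deriv cw cs dsin).
by rewrite mulr1 mulr0 add0r [w + t]addrC /w sinD2pin subrr.
Qed.

(** The hypothesis says that [z] is at distance at least [d] from the integers
0, 1 and -1; by evenness and periodicity the cosine is then compared on
[0, pi], where it decreases. *)
Lemma cos_far (d z : R) : 0 <= d -> d <= `|z| <= 1 - d ->
  cos (2 * pi * z) <= cos (2 * pi * d).
Proof.
move=> d0 /andP[dz z1]; have pi0 := pi_gt0 R.
have key x : d <= x <= 2^-1 -> cos (2 * pi * x) <= cos (2 * pi * d).
  move=> /andP[dx x2].
  have mono u v : 0 <= u -> u <= v -> v <= 2^-1 ->
      0 <= 2 * pi * u <= 2 * pi * v /\ 2 * pi * v <= pi :> R.
    move=> u0 uv v2; split; last first.
      have : pi * v <= pi * 2^-1 :> R by rewrite ler_pM2l.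
      by lra.
    have : pi * u <= pi * v :> R by rewrite ler_pM2l.
    have : 0 <= pi * u :> R by rewrite mulr_ge0// ltW.
    by lra.
  have [/andP[h1 h2] h3] := mono _ _ d0 dx x2.
  rewrite leNgt ltr_cos ?in_itv/= -?leNgt//.
    by rewrite (le_trans h1 h2).
  by rewrite h1 (le_trans h2 h3).
have cosz : cos (2 * pi * z) = cos (2 * pi * `|z|).
  have [z0|z0] := leP 0 z; first by rewrite ger0_norm.
  by rewrite ltr0_norm// mulrN cosN.
rewrite cosz; have [zle|zgt] := leP `|z| 2^-1; first by apply: key; rewrite dz.
rewrite -cosN -(cosD2pin _ 1) mulr1.
rewrite (_ : _ + _ = 2 * pi * (1 - `|z|)); last by ring.
by apply: key; lra.
Qed.

(** Suppose [f y0 > 0].  The trigonometric polynomial [T] exceeds 1 only near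
[y0], where [f] is positive, and lies in [0, 1] elsewhere.  Hence [f * T^n] has
an integral growing at least linearly in [n], with the factor [I g > 0].  But
[f] is orthogonal to every trigonometric function of integer frequency, and
[T^n] is a combination of these, so that integral is 0. *)
Lemma trig_orthogonal_le0 f : C0 f ->
  (forall (k : nat) t, I (fun y => f y * cos (2 * pi * k%:R * y + t)) = 0) ->
  forall y0 : R, 0 < y0 < 1 -> f y0 <= 0.
Proof.
move=> cf fcos y0 /andP[y00 y01]; rewrite leNgt; apply/negP => fy0.
have cfy : {for y0, continuous f}.
  have /(continuous_within_itvP _ ltr01)[cfo _ _] := cf.
  by apply: cfo; rewrite in_itv /= y00.
have [e /= e0 fe] : nbhs y0 [set y | 0 < f y] by exact: cvgr_gt cfy _ fy0.
pose d := Num.min e (Num.min y0 (1 - y0)).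
have d_gt0 : 0 < d by rewrite !lt_min; apply/and3P; split => //; lra.
have de : d <= e by rewrite ge_min lexx.
have dy0 : d <= y0 by rewrite !ge_min lexx orbT.
have dy1 : d <= 1 - y0 by rewrite !ge_min lexx !orbT.
have pi0 := pi_gt0 R.
pose c (k : nat) y := cos (2 * pi * k%:R * y + - (2 * pi * k%:R * y0)).
have cc k : C0 (c k) by exact: C0_cos_affine.
pose T y := 1 + 2^-1 * (c 1%N y - cos (2 * pi * d)).
have cT : C0 T by rewrite /T; c0.
have c1E y : c 1%N y = cos (2 * pi * (y - y0)).
  by rewrite /c mulr1; congr cos; ring.
have orth n k : I (fun y => f y * T y ^+ n * c k y) = 0.
  elim: n k => [|n ih] k.
    by rewrite -[RHS](fcos k (- (2 * pi * k%:R * y0))); apply: eq_torus_integral => y _;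
      rewrite expr0 mulr1.
  (* [k'] is [|k - 1|], as the cosine is even. *)
  pose k' := if k is k''.+1 then k'' else 1%N.
  have c1c y : c 1%N y * c k y = 2^-1 * c k.+1 y + 2^-1 * c k' y.
    have prod u v : cos u * cos v = 2^-1 * cos (u + v) + 2^-1 * cos (u - v) :> R.
      by rewrite cosD cosB; lra.
    rewrite mulrC prod; congr (_ * _ + _ * _).
      by rewrite /c; congr cos; rewrite -natr1; ring.
    rewrite /c /k'; case: (k) => [|k'']; last by congr cos; rewrite -natr1; ring.
    by rewrite -cosN; congr cos; ring.
  pose a := 1 - 2^-1 * cos (2 * pi * d).
  rewrite (_ : (fun y => _) = fun y => a * (f y * T y ^+ n * c k y) +
     (4^-1 * (f y * T y ^+ n * c k.+1 y) + 4^-1 * (f y * T y ^+ n * c k' y))).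
    by rewrite !torus_integralD ?torus_integralZ ?ih ?mulr0 ?addr0//; c0.
  apply/funext => y; rewrite exprS.
  transitivity (f y * T y ^+ n * (a * c k y + 2^-1 * (c 1%N y * c k y))).
    by rewrite /T /a; ring.
  by rewrite c1c; field.
have T_ge0 y : 0 <= T y.
  have c1 : -1 <= c 1%N y by exact: cos_geN1.
  by rewrite /T; have := cos_le1 (2 * pi * d); lra.
(* The positive part, written so that its continuity is immediate. *)
pose pp (x : R) := 2^-1 * (x + `|x|).
have pp_ge0 x : 0 <= pp x.
  by rewrite /pp; have := ler_norm (- x); rewrite normrN; lra.
have ppP x : 0 <= x -> pp x = x by rewrite /pp => x0; rewrite ger0_norm//; lra.
have ppN x : x <= 0 -> pp x = 0 by rewrite /pp => x0; rewrite ler0_norm//; lra.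
pose g y := pp (f y) * pp (T y - 1).
have cg : C0 g by rewrite /g /pp; c0.
have Tfar y : 0 <= y <= 1 -> d <= `|y - y0| -> T y <= 1.
  move=> /andP[y_ge0 y_le1] dy.
  have : cos (2 * pi * (y - y0)) <= cos (2 * pi * d).
    apply: cos_far; first exact: ltW.
    by rewrite dy /= ler_norml; apply/andP; split; lra.
  by rewrite /T c1E; lra.
have main (n : nat) y : 0 <= y <= 1 -> n%:R * g y - `|f y| <= f y * T y ^+ n.
  move=> y_in.
  have [Ty1|Ty1] := leP (T y) 1.
    rewrite /g (ppN (T y - 1)) ?subr_le0// !mulr0 sub0r.
    rewrite lerNl; apply: le_trans (ler_norm _) _.
    by rewrite normrN normrM ler_piMr// ger0_norm ?exprn_ge0// exprn_ile1.
  have fy : 0 < f y.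
    apply: fe => /=; rewrite distrC; apply: lt_le_trans de.
    by rewrite ltNge; apply/negP => /(Tfar _ y_in); rewrite leNgt Ty1.
  rewrite /g ppP ?(ltW fy)// ppP; last by lra.
  have bern : n%:R * (T y - 1) <= T y ^+ n.
    elim: n => [|n ih]; first by rewrite mul0r expr0.
    rewrite exprS -natr1 mulrDl mul1r.
    have h : 1 <= T y ^+ n by rewrite exprn_ege1// ltW.
    have : 0 <= (T y - 1) * (T y ^+ n - 1) by rewrite mulr_ge0//; lra.
    by lra.
  have : f y * (n%:R * (T y - 1)) <= f y * T y ^+ n by rewrite ler_pM2l.
  by have := normr_ge0 (f y); lra.
have J_ge0 : 0 <= I g by apply: torus_integral_ge0 => y _; rewrite mulr_ge0.
have J_gt0 : 0 < I g.
  rewrite lt0r J_ge0 andbT; apply/eqP => J0.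
  have : g y0 = 0.
    by apply: (torus_integral_eq0 cg) => //; [move=> y _; rewrite mulr_ge0|rewrite y00].
  have cd : cos (2 * pi * d) < 1.
    have h1 : pi * d <= pi * 2^-1 :> R by rewrite ler_pM2l//; lra.
    have h2 : 0 < pi * d by rewrite mulr_gt0.
    by rewrite -[ltRHS](@cos0 R) ltr_cos ?in_itv/=; lra.
  rewrite /g ppP ?(ltW fy0)// ppP /T c1E subrr mulr0 cos0; last by lra.
  by apply/eqP; rewrite mulf_neq0 ?gt_eqF//; lra.
have bound (n : nat) : n%:R * I g <= I (fun y => `|f y|).
  have : I (fun y => n%:R * g y - `|f y|) <= I (fun y => f y * T y ^+ n).
    by apply: le_torus_integral; [c0|c0|exact: main].
  have -> : I (fun y => f y * T y ^+ n) = 0.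
    rewrite -[RHS](orth n 0%N); apply: eq_torus_integral => y _.
    by rewrite /c !mulr0 mul0r mul0r oppr0 addr0 cos0 mulr1.
  by rewrite torus_integralB ?torus_integralZ; [lra|c0..].
have If0 : 0 <= I (fun y => `|f y|) by apply: torus_integral_ge0 => y _.
have /archi_boundP : 0 <= I (fun y => `|f y|) / I g by rewrite divr_ge0.
by rewrite ltr_pdivrMr// => /lt_le_trans/(_ (bound _)); rewrite ltxx.
Qed.

(** After subtraction of its mean, [f] is orthogonal to the constants as well,
and [trig_orthogonal_le0] applies to the difference and to its opposite. *)
Lemma du_bois_reymond f : C0 f ->
  (forall (k : nat) t, I (fun y => f y * cos (2 * pi * k.+1%:R * y + t)) = 0) ->
  forall y : R, 0 < y < 1 -> f y = I f.
Proof.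
move=> cf fcos y y01; pose g y := f y - I f.
have cg : C0 g by rewrite /g; c0.
have ccos w t : C0 (fun y : R => cos (w * y + t)) by exact: C0_cos_affine.
have gcos (k : nat) t : I (fun y => g y * cos (2 * pi * k%:R * y + t)) = 0.
  case: k => [|k].
    transitivity (I (fun y => cos t * g y)).
      by apply: eq_torus_integral => z _; rewrite mulr0 mul0r add0r mulrC.
    by rewrite torus_integralZ// torus_integralB// ?torus_integral_cst ?subrr ?mulr0//; exact: C0_cst.
  transitivity (I (fun y => f y * cos (2 * pi * k.+1%:R * y + t)
                       - I f * cos (2 * pi * k.+1%:R * y + t))).
    by apply: eq_torus_integral => z _; rewrite /g mulrBl.
  rewrite torus_integralB; [|c0..]; first by rewrite fcos torus_integralZ// torus_integral_cos mulr0 subrr.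
  - exact: ccos.
  - exact: ccos.
apply/eqP; rewrite eq_le -subr_le0 -/(g y) (trig_orthogonal_le0 cg gcos)//=.
rewrite -subr_le0 -opprB -/(g y).
apply: (@trig_orthogonal_le0 (fun y => - g y)) => //; first by c0.
move=> k t; transitivity (I (fun y => -1 * (g y * cos (2 * pi * k%:R * y + t)))).
  by apply: eq_torus_integral => z _; ring.
by rewrite torus_integralZ ?gcos ?mulr0//; apply: C0M => //; exact: ccos.
Qed.

End DuBoisReymond.

(** * Powers and Young's inequality *)

Section PowR.
Context {R : realType}.
Implicit Types r t : R.

Lemma powR_small r t (e : R) : 0 < r -> 0 <= t -> 0 <= e ->
  t <= e `^ r^-1 -> t `^ r <= e.
Proof.
move=> r0 t0 e0 te.
have <- : (e `^ r^-1) `^ r = e by rewrite -powRrM mulVf ?powRr1// gt_eqF.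
by rewrite ge0_ler_powR ?nnegrE ?powR_ge0// ltW.
Qed.

Lemma hoelder_continuous (f : R -> R) (K r : R) : 0 < r ->
  (forall x y, `|f x - f y| <= K * `|x - y| `^ r) -> continuous f.
Proof.
move=> r0 fK x; apply/cvgrPdist_le => e e0.
have k0 : 0 < `|K| + 1 by rewrite ltr_wpDl.
have d0 : 0 < (e / (`|K| + 1)) `^ r^-1 by rewrite powR_gt0// divr_gt0.
apply: filterS (nbhsx_ballx x _ d0) => y /ltW /= xy.
apply: le_trans (fK x y) _.
have : `|x - y| `^ r <= e / (`|K| + 1).
  by apply: powR_small => //; rewrite divr_ge0// ltW.
rewrite ler_pdivlMr// mulrC; apply: le_trans.
by rewrite ler_wpM2r ?powR_ge0//; have := ler_norm K; lra.
Qed.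

Lemma continuous_powR_norm r : 0 < r -> continuous (fun t => `|t| `^ r).
Proof.
move=> r0 t; have [->|t0] := eqVneq t 0; last first.
  have cp : {for `|t|, continuous (fun x : R => x `^ r)}.
    apply/differentiable_continuous/derivable1_diffP.
    have nt0 : 0 < `|t| by rewrite normr_gt0.
    by have [] := is_derive1_powR r nt0.
  have cn : {for t, continuous (fun z : R => `|z|)} by exact: norm_continuous.
  exact: (continuous_comp cn cp).
apply/cvgrPdist_le => e e0.
have d0 : 0 < e `^ r^-1 by rewrite powR_gt0.
apply: filterS (nbhsx_ballx (0 : R) _ d0) => y /ltW /=.
rewrite sub0r normrN normr0 powR0 ?gt_eqF// sub0r normrN => ye.
by rewrite ger0_norm ?powR_ge0//; apply: powR_small => //; exact: ltW.
Qed.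

Lemma C0_eq (f g : R -> R) : (forall y, 0 <= y <= 1 -> f y = g y) ->
  C0 f -> C0 g.
Proof.
move=> fg; apply: subspace_eq_continuous => y; rewrite inE /= in_itv; exact: fg.
Qed.

(** At a zero of [f], [powR] is not continuous on the left; passing to the norm,
which changes nothing on [0, 1], gives an outer function continuous on the
whole line. *)
Lemma C0_powR (f : R -> R) r : 0 < r -> (forall y, 0 <= y <= 1 -> 0 <= f y) ->
  C0 f -> C0 (fun y => f y `^ r).
Proof.
move=> r0 f0 cf; apply: (@C0_eq (fun y => `|f y| `^ r)).
  by move=> y /f0 fy; rewrite ger0_norm.
move=> x; apply: (@continuous_comp _ _ _ (f : subspace `[0, 1] -> R) (fun t : R => `|t| `^ r)).
  exact: cf.
exact: continuous_powR_norm.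
Qed.

(** With [b = a e^s], division by [a^q b] reduces the claim to
[q + 1 < q e^(-s) + e^(q s)], the sum of two tangent inequalities of the
exponential, the first of which is strict unless [s = 0]. *)
Lemma young_lt (q a b : R) : 0 < q -> 0 < a -> 0 < b -> a != b ->
  (q + 1) * (b * a `^ q) < q * (a `^ q * a) + b `^ q * b.
Proof.
move=> q0 a0 b0 ab; pose s := ln b - ln a.
have s0 : s != 0.
  rewrite subr_eq0; apply: contra ab => /eqP lnE; apply/eqP/esym.
  by apply: ln_inj; rewrite ?posrE.
have bE : b = a * expR s by rewrite expRB !lnK ?posrE// mulrC divfK// gt_eqF.
have bqE : b `^ q = a `^ q * expR (q * s).
  by rewrite bE powRM ?expR_ge0 ?ltW// [q * s]mulrC expRM.
have e1 : 1 - s < expR (- s) by rewrite expR_gt1Dx// oppr_eq0.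
have e2 := expR_ge1Dx (q * s).
have : q + 1 < q * expR (- s) + expR (q * s).
  by have : q * (1 - s) < q * expR (- s); [rewrite ltr_pM2l|lra].
have k : 0 < a `^ q * b by rewrite mulr_gt0// powR_gt0.
have aE : a = b * expR (- s) by rewrite {1}bE -mulrA -expRD subrr expR0 mulr1.
rewrite -(ltr_pM2l k) bqE; move: (a `^ q) => A.
have -> : q * (A * a) = A * b * (q * expR (- s)) by rewrite {1}aE; ring.
by lra.
Qed.

Lemma young_le (q a b : R) : 0 < q -> 0 <= a -> 0 <= b ->
  (q + 1) * (b * a `^ q) <= q * (a `^ q * a) + b `^ q * b.
Proof.
move=> q0; rewrite le_eqVlt => /predU1P[<- b0|a0].
  by rewrite powR0 ?gt_eqF// !(mulr0, mul0r) add0r mulr_ge0 ?powR_ge0.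
rewrite le_eqVlt => /predU1P[<-|b0].
  by rewrite !(mulr0, mul0r) addr0 !mulr_ge0 ?powR_ge0// ltW.
have [->|ab] := eqVneq a b; first by lra.
exact/ltW/young_lt.
Qed.

End PowR.

(** * The cell system as a first order system *)

(** The cell system for [p = u' + P] at [alpha = 1].  The integral in [cls_dm]
is the constant value of the flux [m' + m p]: it is the mean of [m p], because
[m'] has mean 0. *)
Record classical (R : realType) (q : R) (v : R -> R) (P c : R)
    (p m : R -> R) : Prop := Classical {
  cls_v : C0 v;
  cls_p : C0 p;
  cls_m : C0 m;
  cls_ge0 : forall y, 0 <= y <= 1 -> 0 <= m y;
  cls_p01 : p 0 = p 1;
  cls_m01 : m 0 = m 1;
  cls_Ip : torus_integral p = P;
  cls_Im : torus_integral m = 1;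
  cls_dp : forall y : R, 0 < y < 1 ->
    is_derive y 1 p (p y ^+ 2 / 2 - v y - m y `^ q - c);
  cls_dm : forall y : R, 0 < y < 1 ->
    is_derive y 1 m (torus_integral (fun z => m z * p z) - m y * p y) }.

Section CellClassical.
Context {R : realType}.
Implicit Types f g : R -> R.
Local Notation I := (@torus_integral R).

Lemma derive1_periodic f : periodic f 1 -> periodic (derive1 f) 1.
Proof.
move=> fp x; rewrite /derive1 fp.
by under eq_fun => h do rewrite addrA fp.
Qed.

Lemma derivable_continuous f : (forall x, derivable f x 1) -> continuous f.
Proof.
by move=> df x; apply: differentiable_continuous; exact/derivable1_diffP.
Qed.

Lemma derive1n_cos_affine (n : nat) (w t : R) :
  derive1n n (fun y => cos (w * y + t)) =
  fun y => w ^+ n * cos (w * y + (t + n%:R * (pi / 2))).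
Proof.
elim: n => [|n ih].
  by apply/funext => y /=; rewrite expr0 mul1r mul0r addr0.
rewrite derive1nS ih; apply/funext => y.
set t' := t + n%:R * (pi / 2); have ? := is_derive_cos_affine w t' y.
rewrite derive1E deriveZ//= derive_val /GRing.scale /=.
rewrite (_ : t + _ = t' + pi / 2); last by rewrite /t' -natr1; ring.
by rewrite [w * y + (t' + _)]addrA cosDpihalf exprS; ring.
Qed.

Lemma torus_smooth_cos (k : nat) (t : R) :
  torus_smooth (fun y => cos (2 * pi * k%:R * y + t)).
Proof.
split; first by move=> y; rewrite -[RHS](cosD2pin _ k); congr cos; ring.
move=> n x; rewrite derive1n_cos_affine.
by apply: derivableM => //; have [] := is_derive_cos_affine (2 * pi * k%:R) (t + n%:R * (pi / 2)) x.
Qed.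

(** With [Q] an antiderivative of [m p] and [b] its increment over a period, the
weak equation tested with a trigonometric function says, after integration by
parts, that [m + Q - b y] is orthogonal to all nonconstant trigonometric
functions.  It is therefore constant, which gives a pointwise derivative of
[m]. *)
Lemma weak_flux_const (p m : R -> R) : C0 p -> C0 m ->
  (forall phi, torus_smooth phi ->
     I (fun y => - (m y * derive1n 2 phi y) + m y * p y * derive1 phi y) = 0) ->
  forall y : R, 0 < y < 1 -> is_derive y 1 m (I (fun z => m z * p z) - m y * p y).
Proof.
move=> cp cm weak; have cmp : C0 (fun y => m y * p y) by c0.
have [Q [cQ dQ]] := C0_antiderivative cmp.
set b := I _.
have QE : b = Q 1 - Q 0 by exact: torus_integral_deriv cmp cQ dQ.
pose f y := m y + Q y - b * y.
have cf : C0 f by rewrite /f; c0.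
have ortho (k : nat) t : I (fun y => f y * cos (2 * pi * k.+1%:R * y + t)) = 0.
  pose w := 2 * pi * k.+1%:R : R.
  have w0 : w != 0 by rewrite !mulf_neq0// ?pnatr_eq0// gt_eqF// pi_gt0.
  pose C y := cos (w * y + t); pose S y := sin (w * y + t).
  have cC : C0 C by exact: C0_cos_affine.
  have cS : C0 S by exact: C0_sin_affine.
  have dS (y : R) : is_derive y 1 S (w * C y) by exact: is_derive_sin_affine.
  have S1 : S 1 = S 0.
    by rewrite /S mulr1 mulr0 add0r [w + t]addrC /w sinD2pin.
  have IS : I S = 0.
    rewrite -[RHS](torus_integral_cos k (t - pi / 2)); apply: eq_torus_integral => y _.
    by rewrite addrA cosBpihalf.
  have weakC : w * I (fun y => m y * C y) = I (fun y => m y * p y * S y).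
    have := weak _ (torus_smooth_cos k.+1 t); rewrite derive1n_cos_affine.
    rewrite -/w => weakE; apply: (mulfI w0); apply/eqP; rewrite -subr_eq0; apply/eqP.
    rewrite -[RHS]weakE -!torus_integralZ; [|c0..]; rewrite -torus_integralB; [|c0..].
    apply: eq_torus_integral => y _; have ? := is_derive_cos_affine w t y.
    rewrite derive1E derive_val mulr2n mulrDl !mul1r -splitr addrA cosDpi -/(C y) -/(S y).
    by ring.
  have QC : I (fun y => m y * p y * S y) + w * I (fun y => Q y * C y) = b * S 0.
    rewrite -torus_integralZ; last by c0.
    rewrite -torus_integralD; [|c0..].
    have dQS (y : R) : 0 < y < 1 -> is_derive y 1 (fun y => Q y * S y)
        (m y * p y * S y + w * (Q y * C y)).
      move=> y01; have ? := dQ _ y01; have ? := dS y.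
      by apply: is_derive_eq; rewrite /GRing.scale /=; ring.
    by rewrite (torus_integral_deriv _ _ dQS); [rewrite S1 QE; ring|c0..].
  have yC : w * I (fun y => y * C y) = S 0.
    transitivity (I (fun y => S y + w * (y * C y))).
      by rewrite torus_integralD ?torus_integralZ ?IS ?add0r//; c0.
    have dyS (y : R) : 0 < y < 1 -> is_derive y 1 (fun y => y * S y)
        (S y + w * (y * C y)).
      move=> y01; have ? := dS y.
      by apply: is_derive_eq; rewrite /GRing.scale /=; ring.
    by rewrite (torus_integral_deriv _ _ dyS); [rewrite S1; ring|c0..].
  apply: (mulfI w0); rewrite mulr0.
  transitivity (w * (I (fun y => m y * C y) + I (fun y => Q y * C y) - b * I (fun y => y * C y))).
    congr (_ * _); rewrite -torus_integralZ; last by c0.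
    rewrite -torus_integralD; [|c0..]; rewrite -torus_integralB; [|c0..].
    by apply: eq_torus_integral => y _; rewrite /f /C /w; ring.
  by rewrite mulrBr mulrDr weakC QC mulrCA yC subrr.
move=> y y01; have fE := du_bois_reymond cf ortho.
have dlin : is_derive y 1 (fun z => I f - Q z + b * z) (b - m y * p y).
  have ? := dQ _ y01.
  by apply: is_derive_eq; rewrite /GRing.scale /=; ring.
apply: near_eq_is_derive dlin; near=> z.
have z01 : 0 < z < 1 by near: z; exact: near_oo.
by rewrite -(fE _ z01) /f; ring.
Unshelve. all: by end_near. Qed.

(** The first equation holds at every point, so it expresses [m^q], and hence
[m], as a continuous function; this is what lets [weak_flux_const] apply. *)
Lemma classical_of_cell (q : R) (v : R -> R) (P c : R) (u m : R -> R) :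
  0 < q -> continuous v -> cell_solution q v P 1 c u m ->
  classical q v P c (fun y => derive1 u y + P) m.
Proof.
move=> q0 cv [uC2 [mW m0] eqn weak [Iu Im]].
have [up du ddu [K hK]] : torus_C2 (2^-1) u by apply: uC2; lra.
have cdu : continuous (derive1 u) by exact: derivable_continuous.
have cddu : continuous (derive1n 2 u) by apply: (hoelder_continuous _ hK); lra.
have mp : periodic m 1.
  by have [|[]] := mW 2; [lra|].
have mqE y : m y `^ q = - derive1n 2 u y + (derive1 u y + P) ^+ 2 / 2 - v y - c.
  by have := eqn y; rewrite powR1 mul1r real_normK ?num_real//; lra.
have cp : C0 (fun y => derive1 u y + P).
  by have cdu0 := C0_continuous cdu; c0.
have cm : C0 m.
  apply: (@C0_eq _ (fun y => (m y `^ q) `^ q^-1)).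
    by move=> y _; rewrite -powRrM mulfV ?gt_eqF// powRr1.
  apply: C0_powR; [by rewrite invr_gt0|by move=> y _; exact: powR_ge0|].
  have := C0_continuous cddu; have := C0_continuous cv => ? ?.
  by rewrite (funext mqE); c0.
split => //.
- exact: C0_continuous.
- by have := derive1_periodic up 0; rewrite add0r => ->.
- by have := mp 0; rewrite add0r => ->.
- have cdu0 := C0_continuous cdu.
  have cu : C0 u by apply: C0_continuous; exact: derivable_continuous.
  have du' (y : R) : 0 < y < 1 -> is_derive y 1 u (derive1 u y).
    by move=> _; rewrite derive1E; exact/derivableP.
  rewrite torus_integralD; [|by []|exact: C0_cst];
    rewrite torus_integral_cst (torus_integral_deriv cdu0 cu du').
  by have := up 0; rewrite add0r => ->; rewrite subrr add0r.
- move=> y _; have := mqE y => mqy.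
  have -> : (derive1 u y + P) ^+ 2 / 2 - v y - m y `^ q - c = derive1n 2 u y + 0.
    by lra.
  have ? : is_derive y 1 (derive1 u) (derive1n 2 u y).
    by rewrite /derive1n /= [X in is_derive _ _ _ X]derive1E; exact/derivableP.
  exact: is_deriveD.
- exact: weak_flux_const cp cm weak.
Qed.

End CellClassical.

(** * Duality identities and a priori bounds *)

Section CrossIdentities.
Context {R : realType}.
Context (q : R) (q_gt0 : 0 < q).
Local Notation I := (@torus_integral R).

(** For a solution this is the effective drift. *)
Definition flux (p m : R -> R) : R := I (fun y => m y * p y).

Definition coupling_energy (m : R -> R) : R := I (fun y => m y `^ q * m y).

Lemma classical_C0_powR v P c p m : classical q v P c p m ->
  C0 (fun y => m y `^ q).
Proof. by case=> *; exact: C0_powR. Qed.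

(** Comparison with the solution without potential is the source of all bounds
that are uniform in [P]. *)
Lemma classical_trivial P :
  classical q (fun=> 0) P (P ^+ 2 / 2 - 1) (fun=> P) (fun=> 1).
Proof.
split => //; try exact: C0_cst; try exact: torus_integral_cst.
- move=> y _; apply: is_derive_eq; rewrite powR1; lra.
- by move=> y _; apply: is_derive_eq; rewrite torus_integral_cst; lra.
Qed.

Lemma powR_monotone (a b : R) : 0 <= a -> 0 <= b ->
  0 <= (a `^ q - b `^ q) * (a - b).
Proof.
move=> a0 b0; have [ab|/ltW ba] := leP a b.
  rewrite -mulrNN mulr_ge0// oppr_ge0 subr_le0//.
  by rewrite ge0_ler_powR ?nnegrE// ltW.
by rewrite mulr_ge0// subr_ge0// ge0_ler_powR ?nnegrE// ltW.
Qed.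

(** The product [m2 (p1 - p2)] is periodic, so its derivative has integral 0.
Expanding that derivative with the two equations, the terms linear in
[p1 - p2] combine into [m2' + m2 p2], the constant flux of the second
solution. *)
Lemma cross_identity v1 v2 P1 P2 c1 c2 p1 p2 m1 m2 :
  classical q v1 P1 c1 p1 m1 -> classical q v2 P2 c2 p2 m2 ->
  c1 - c2 = flux p2 m2 * (P1 - P2) + 2^-1 * I (fun y => m2 y * (p1 y - p2 y) ^+ 2)
    - I (fun y => (m1 y `^ q - m2 y `^ q) * m2 y) - I (fun y => (v1 y - v2 y) * m2 y).
Proof.
move=> s1 s2; have cq1 := classical_C0_powR s1; have cq2 := classical_C0_powR s2.
case: s1 => cv1 cp1 cm1 _ p01 m01 Ip1 Im1 dp1 dm1.
case: s2 => cv2 cp2 cm2 _ p02 m02 Ip2 Im2 dp2 dm2.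
rewrite -/(flux p2 m2) in dm2; set b2 := flux p2 m2 in dm2 *.
pose w y := (b2 - m2 y * p2 y) * (p1 y - p2 y) +
  m2 y * ((p1 y ^+ 2 / 2 - v1 y - m1 y `^ q - c1) - (p2 y ^+ 2 / 2 - v2 y - m2 y `^ q - c2)).
have cw : C0 w by rewrite /w; c0.
have dW (y : R) : 0 < y < 1 -> is_derive y 1 (fun y => m2 y * (p1 y - p2 y)) (w y).
  move=> y01; have ? := dp1 _ y01; have ? := dp2 _ y01; have ? := dm2 _ y01.
  by apply: is_derive_eq; rewrite /GRing.scale /= /w; ring.
have Iw : I w = 0.
  by rewrite (torus_integral_deriv cw _ dW); [rewrite m02 p01 p02 subrr|c0].
have : I (fun y => b2 * (p1 y - p2 y) + 2^-1 * (m2 y * (p1 y - p2 y) ^+ 2)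
   - (m1 y `^ q - m2 y `^ q) * m2 y - (v1 y - v2 y) * m2 y - (c1 - c2) * m2 y) = 0.
  by rewrite -Iw; apply: eq_torus_integral => y _; rewrite /w; field.
rewrite !torus_integralB; [|c0..];
  rewrite !torus_integralD; [|c0..];
  rewrite !torus_integralZ; [|c0..].
by rewrite !torus_integralB; [|c0..]; rewrite Ip1 Ip2 Im2; lra.
Qed.

(** The sum of [cross_identity] and of its mirror image, in which the constants
[c1] and [c2] cancel: the Lasry-Lions monotonicity formula. *)
Lemma cross_sum v1 v2 P1 P2 c1 c2 p1 p2 m1 m2 :
  classical q v1 P1 c1 p1 m1 -> classical q v2 P2 c2 p2 m2 ->
  2^-1 * I (fun y => (m1 y + m2 y) * (p1 y - p2 y) ^+ 2) +
    I (fun y => (m1 y `^ q - m2 y `^ q) * (m1 y - m2 y)) +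
    I (fun y => (v1 y - v2 y) * (m1 y - m2 y)) =
  (flux p1 m1 - flux p2 m2) * (P1 - P2).
Proof.
move=> s1 s2; have cq1 := classical_C0_powR s1; have cq2 := classical_C0_powR s2.
have e1 := cross_identity s1 s2; have e2 := cross_identity s2 s1.
case: s1 => cv1 cp1 cm1 _ p01 m01 Ip1 Im1 dp1 dm1.
case: s2 => cv2 cp2 cm2 _ p02 m02 Ip2 Im2 dp2 dm2.
have -> : I (fun y => (m1 y + m2 y) * (p1 y - p2 y) ^+ 2) =
    I (fun y => m2 y * (p1 y - p2 y) ^+ 2) + I (fun y => m1 y * (p2 y - p1 y) ^+ 2).
  by rewrite -torus_integralD; [apply: eq_torus_integral => y _; ring|c0..].
have -> : I (fun y => (m1 y `^ q - m2 y `^ q) * (m1 y - m2 y)) =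
    - I (fun y => (m1 y `^ q - m2 y `^ q) * m2 y) - I (fun y => (m2 y `^ q - m1 y `^ q) * m1 y).
  rewrite -mulN1r -torus_integralZ; [|c0]; rewrite -torus_integralB; [|c0..].
  by apply: eq_torus_integral => y _; ring.
have -> : I (fun y => (v1 y - v2 y) * (m1 y - m2 y)) =
    - I (fun y => (v1 y - v2 y) * m2 y) - I (fun y => (v2 y - v1 y) * m1 y).
  rewrite -mulN1r -torus_integralZ; [|c0]; rewrite -torus_integralB; [|c0..].
  by apply: eq_torus_integral => y _; ring.
by lra.
Qed.

Context (v : R -> R) (V : R) (V_gt0 : 0 < V).
Context (v_bd : forall y : R, 0 <= y <= 1 -> 0 <= v y <= V).

(** [cross_sum] against the solution without potential and with the same [P]:
the right-hand side is 0, and the potential term is at least [- V]. *)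
Lemma energy_bound P c p m : classical q v P c p m ->
  I (fun y => (p y - P) ^+ 2) <= 2 * V /\
  I (fun y => m y * (p y - P) ^+ 2) <= 2 * V.
Proof.
move=> s; have := cross_sum s (classical_trivial P); rewrite subrr mulr0.
have cq := classical_C0_powR s.
case: s => cv cp cm m0 p01 m01 Ip Im dp dm.
have mono : 0 <= I (fun y => (m y `^ q - 1 `^ q) * (m y - 1)).
  by apply: torus_integral_ge0 => y /m0 my; exact: powR_monotone.
have vm : - V <= I (fun y => (v y - 0) * (m y - 1)).
  rewrite -(torus_integral_cst (- V)); apply: le_torus_integral; [c0|c0|] => y y01.
  have /andP[vy0 vyV] := v_bd y01.
  by have := mulr_ge0 vy0 (m0 _ y01); lra.
have n1 : 0 <= I (fun y => (p y - P) ^+ 2) by apply: torus_integral_ge0 => y _; exact: sqr_ge0.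
have n2 : 0 <= I (fun y => m y * (p y - P) ^+ 2).
  by apply: torus_integral_ge0 => y /m0 my; rewrite mulr_ge0// sqr_ge0.
have -> : I (fun y => (m y + 1) * (p y - P) ^+ 2) =
    I (fun y => m y * (p y - P) ^+ 2) + I (fun y => (p y - P) ^+ 2).
  by rewrite -torus_integralD; [apply: eq_torus_integral => y _; ring|c0..].
by lra.
Qed.

(** Testing [m' = b - m p] with [m'] bounds the square of the L^2 norm of [m'] by
[max m] times the energy of [energy_bound], hence by [2 V max m].  As [m]
exceeds its mean 1 by at most the L^1 norm of [m'], this yields
[max m - 1 <= (max m)/2 + V]. *)
Lemma density_bound P c p m : classical q v P c p m ->
  forall y, 0 <= y <= 1 -> m y <= 2 + 2 * V.
Proof.
move=> s; have [_ eb] := energy_bound s.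
case: s => cv cp cm m0 p01 m01 Ip Im dp dm; rewrite -/(flux p m) in dm.
set b := flux p m in dm; pose g y := b - m y * p y.
have cg : C0 g by rewrite /g; c0.
have [x x01 mx] := EVT_max ler01 cm; rewrite in_itv /= in x01.
have {}mx y : 0 <= y <= 1 -> m y <= m x by move=> y01; apply: mx; rewrite in_itv.
have Ig : I g = 0 by rewrite (torus_integral_deriv cg cm dm) m01 subrr.
have Img : I (fun y => m y * g y) = 0.
  have dmm (y : R) : 0 < y < 1 -> is_derive y 1 (fun y => 2^-1 * m y ^+ 2) (m y * g y).
    move=> y01; have ? := dm _ y01.
    by apply: is_derive_eq; rewrite /GRing.scale /=; rewrite /g; field.
  by rewrite (torus_integral_deriv _ _ dmm); [rewrite m01 subrr|c0..].
have Igg : I (fun y => g y ^+ 2) <= m x * (2 * V).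
  apply: (@le_trans _ _ (m x * I (fun y => m y * (p y - P) ^+ 2))); last first.
    by apply: ler_wpM2l => //; exact: m0.
  have e : I (fun y => g y ^+ 2) = - I (fun y => m y * (p y - P) * g y).
    have : I (fun y => b * g y - P * (m y * g y) - m y * (p y - P) * g y - g y ^+ 2) = 0.
      rewrite -[RHS](torus_integral_cst 0); apply: eq_torus_integral => y _; rewrite /g; ring.
    by rewrite !torus_integralB ?torus_integralZ; [rewrite Ig Img; lra|c0..].
  have : - I (fun y => m y * (p y - P) * g y) <=
      2^-1 * I (fun y => g y ^+ 2) + 2^-1 * (m x * I (fun y => m y * (p y - P) ^+ 2)).
    rewrite -mulN1r -!torus_integralZ; [|c0..]; rewrite -torus_integralD; [|c0..].
    apply: le_torus_integral; [c0|c0|] => y y01.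
    have h1 : 0 <= (g y + m y * (p y - P)) ^+ 2 by exact: sqr_ge0.
    have h2 : m y * (m y * (p y - P) ^+ 2) <= m x * (m y * (p y - P) ^+ 2).
      by apply: ler_wpM2r; [rewrite mulr_ge0 ?sqr_ge0 ?m0|exact: mx].
    by lra.
  by rewrite -e; lra.
(* [|g| <= g^2/(4V) + V], the weight that leaves half of [max m]. *)
have Iabs : I (fun y => `|g y|) <= 2^-1 * m x + V.
  have V4 : 0 < 4 * V by rewrite mulr_gt0.
  have V40 : 4 * V != 0 by rewrite gt_eqF.
  apply: (@le_trans _ _ (I (fun y => (4 * V)^-1 * g y ^+ 2 + V))).
    apply: le_torus_integral; [c0|c0|] => y _.
    rewrite -(ler_pM2l V4).
    rewrite mulrDr mulrA divff// mul1r.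
    have := sqr_ge0 (`|g y| - 2 * V); rewrite sqrrB real_normK ?num_real//.
    by lra.
  rewrite torus_integralD; [|c0..];
    rewrite torus_integralZ; [|c0..];
    rewrite torus_integral_cst lerD2r.
  rewrite -(ler_pM2l V4).
  by rewrite mulrA divff// mul1r; lra.
have := dist_mean_le cm cg dm x01; rewrite Im => /(le_trans (ler_norm _)) d1.
by move=> y /mx my; lra.
Qed.

End CrossIdentities.

Section UniformBounds.
Context {R : realType}.
Context (q : R) (q_gt0 : 0 < q).
Local Notation I := (@torus_integral R).
Context (v : R -> R) (V : R) (V_gt0 : 0 < V).
Context (v_bd : forall y : R, 0 <= y <= 1 -> 0 <= v y <= V).

(** The oscillation of [p] is at most the integral of [`|p'|], which the equation
of [p] expresses through the energy, the potential and [m^q]; the constant [c]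
is bounded by integrating that same equation. *)
Lemma gradient_bound (B P c : R) p m : `|P| <= B -> classical q v P c p m ->
  forall y, 0 <= y <= 1 ->
    `|p y| <= B + B ^+ 2 + 4 * V + 2 * (2 + 2 * V) `^ q.
Proof.
move=> PB s y y01; set M := 2 + 2 * V.
have M0 : 0 <= M by rewrite addr_ge0// mulr_ge0// ltW.
have mM := density_bound q_gt0 V_gt0 v_bd s.
have [ep _] := energy_bound q_gt0 v_bd s.
have cq := classical_C0_powR q_gt0 s.
case: s => cv cp cm m0 p01 m01 Ip Im dp dm.
have cF : C0 (fun y => p y ^+ 2 / 2 - v y - m y `^ q - c) by c0.
have Ipp : I (fun y => p y ^+ 2) <= B ^+ 2 + 2 * V.
  have : I (fun y => (p y - P) ^+ 2) = I (fun y => p y ^+ 2 - 2 * P * p y + P ^+ 2).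
    by apply: eq_torus_integral => z _; ring.
  rewrite torus_integralD; [|c0..];
    rewrite torus_integralB; [|c0..];
    rewrite torus_integralZ; [|c0..];
    rewrite torus_integral_cst Ip.
  have : P ^+ 2 <= B ^+ 2.
    by rewrite -[P ^+ 2]real_normK ?num_real// lerXn2r ?nnegrE// (le_trans _ PB).
  by lra.
have Ipp0 : 0 <= I (fun y => p y ^+ 2) by apply: torus_integral_ge0 => z _; exact: sqr_ge0.
have Iv0 : 0 <= I v by apply: torus_integral_ge0 => z /v_bd/andP[].
have IvV : I v <= V.
  by rewrite -(torus_integral_cst V); apply: le_torus_integral; [c0|c0|move=> z /v_bd/andP[]].
have Iq0 : 0 <= I (fun y => m y `^ q) by apply: torus_integral_ge0 => z _; exact: powR_ge0.
have IqM : I (fun y => m y `^ q) <= M `^ q.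
  rewrite -(torus_integral_cst (M `^ q)); apply: le_torus_integral; [c0|c0|] => z z01.
  by apply: ge0_ler_powR; rewrite ?nnegrE ?(ltW q_gt0) ?m0 ?mM.
have IF : 2^-1 * I (fun y => p y ^+ 2) - I v - I (fun y => m y `^ q) - c = 0.
  have := torus_integral_deriv cF cp dp; rewrite p01 subrr => <-.
  rewrite -torus_integralZ; [|c0];
    rewrite -(torus_integral_cst c) -!torus_integralB; [|c0..].
  by apply: eq_torus_integral => z _; rewrite torus_integral_cst; field.
have cB : `|c| <= 2^-1 * (B ^+ 2 + 2 * V) + V + M `^ q.
  by rewrite ler_norml; apply/andP; split; lra.
have := dist_mean_le cp cF dp y01; rewrite Ip => d1.
have : I (fun y => `|p y ^+ 2 / 2 - v y - m y `^ q - c|) <=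
    I (fun y => 2^-1 * p y ^+ 2 + v y + m y `^ q + `|c|).
  apply: le_torus_integral; [c0|c0|] => z z01; have /andP[vz0 _] := v_bd z01.
  have := sqr_ge0 (p z); have := powR_ge0 (m z) q.
  have := ler_norm c; have := ler_norm (- c); rewrite normrN => *.
  by rewrite ler_norml; apply/andP; split; lra.
rewrite !torus_integralD; [|c0..];
  rewrite torus_integralZ; [|c0..];
  rewrite torus_integral_cst => d2.
have -> : p y = (p y - P) + P by ring.
apply: le_trans (ler_normD _ _) _; lra.
Qed.

(** A Harnack inequality.  With [U] an antiderivative of [p], the function
[m e^U] has derivative [b e^U] of constant sign, hence is monotone, while [U]
varies by at most [S] on [0, 1].  Starting from a point where [m >= 1], every
point is reached in one monotone step, or in two through the identification of
0 with 1; the factor 2 in the exponent accounts for the latter. *)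
Lemma density_lower_bound (S P c : R) p m : classical q v P c p m ->
  (forall y, 0 <= y <= 1 -> `|p y| <= S) ->
  forall y, 0 <= y <= 1 -> expR (- (2 * S)) <= m y.
Proof.
case=> cv cp cm m0 p01 m01 Ip Im dp dm pS.
set b := I _ in dm.
have [U [cU dU]] := C0_antiderivative cp.
have cE : C0 (fun y => expR (U y)).
  move=> z; apply: (@continuous_comp _ _ _ (U : subspace `[0, 1] -> R) expR).
    exact: cU.
  exact: continuous_expR.
have oo (y : R) : 0 < y < 1 -> - S <= p y <= S.
  by move=> /andP[y0 y1]; rewrite -ler_norml pS// !ltW.
have S0 : 0 <= S by apply: le_trans (normr_ge0 _) (pS 0 _); rewrite lexx ler01.
have U1 : forall x y : R, 0 <= x -> x <= y -> y <= 1 -> S * x - U x <= S * y - U y.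
  apply: (@nondecreasing_of_deriv _ (fun y => S - p y)); first by c0.
    by move=> y y01; have ? := dU _ y01; apply: is_derive_eq; rewrite /GRing.scale /=; ring.
  by move=> y /oo; lra.
have U2 : forall x y : R, 0 <= x -> x <= y -> y <= 1 -> S * x + U x <= S * y + U y.
  apply: (@nondecreasing_of_deriv _ (fun y => S + p y)); first by c0.
    by move=> y y01; have ? := dU _ y01; apply: is_derive_eq; rewrite /GRing.scale /=; ring.
  by move=> y /oo; lra.
have USd x y : 0 <= x -> x <= y -> y <= 1 -> `|U y - U x| <= S.
  move=> x0 xy y1; have u1 := U1 _ _ x0 xy y1; have u2 := U2 _ _ x0 xy y1.
  have : S * (y - x) <= S * 1 by apply: ler_wpM2l => //; lra.
  by rewrite ler_norml => ?; apply/andP; split; lra.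
have dE (y : R) : 0 < y < 1 ->
    is_derive y 1 (fun y => m y * expR (U y)) (b * expR (U y)).
  move=> y01; have ? := dU _ y01; have ? := dm _ y01.
  have ? : is_derive y 1 (fun y => expR (U y)) (expR (U y) * p y).
    exact: (is_derive1_comp (is_derive_expR _) (dU _ y01)).
  by apply: is_derive_eq; rewrite /GRing.scale /=; ring.
have cmE : C0 (fun y => m y * expR (U y)) by c0.
have harnack x y : 0 <= x <= 1 -> `|U y - U x| <= S ->
    m x * expR (U x) <= m y * expR (U y) -> m x * expR (- S) <= m y.
  move=> x01 USxy h; have ey := expR_gt0 (U y).
  rewrite -(ler_pM2r ey); apply: le_trans h.
  rewrite -mulrA -expRD ler_wpM2l ?m0// ler_expR.
  by move: USxy; rewrite ler_norml => /andP[_]; lra.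
have [x + mx] := EVT_max ler01 cm; rewrite in_itv /= => x01.
have mx1 : 1 <= m x.
  rewrite -Im -[leRHS]torus_integral_cst; apply: le_torus_integral; [c0|c0|] => y y01.
  by apply: mx; rewrite in_itv.
have e1 : expR (- S) <= 1 by rewrite -expR0 ler_expR; lra.
have ee : expR (- (2 * S)) = expR (- S) * expR (- S) by rewrite -expRD; congr expR; ring.
have e0 := expR_gt0 (- S).
have fin t z : m x * expR (- S) <= t -> t * expR (- S) <= z -> expR (- (2 * S)) <= z.
  move=> h1 h2; rewrite ee; apply: le_trans h2; rewrite ler_wpM2r ?(ltW e0)//.
  by apply: le_trans h1; rewrite ler_peMl// ltW.
have fin1 z : m x * expR (- S) <= z -> expR (- (2 * S)) <= z.
  move=> h; apply: (fin _ _ h); rewrite ler_piMr//.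
  by apply: le_trans h; rewrite mulr_ge0 ?m0// ltW.
have x0 := (andP x01).1; have x1 := (andP x01).2.
move=> y /andP[y0 y1]; have [b0|/ltW b0] := leP 0 b.
  have nd : forall x y : R, 0 <= x -> x <= y -> y <= 1 ->
      m x * expR (U x) <= m y * expR (U y).
    by apply: (nondecreasing_of_deriv cmE dE) => z _; rewrite mulr_ge0// expR_ge0.
  have up z t : 0 <= z -> z <= t -> t <= 1 -> m z * expR (- S) <= m t.
    move=> z0 zt t1; apply: harnack; [by rewrite z0 (le_trans zt)|exact: USd|exact: nd].
  have [xy|/ltW yx] := leP x y; first by apply: fin1; exact: up.
  by apply: (fin (m 0)); [rewrite m01|]; apply: up.
have nd : forall x y : R, 0 <= x -> x <= y -> y <= 1 ->
    - (m x * expR (U x)) <= - (m y * expR (U y)).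
  apply: (@nondecreasing_of_deriv _ (fun y => - (b * expR (U y)))); first by c0.
    by move=> z z01; have ? := dE _ z01; exact: is_deriveN.
  by move=> z _; rewrite -mulNr mulr_ge0 ?expR_ge0// oppr_ge0.
have dn z t : 0 <= z -> z <= t -> t <= 1 -> m t * expR (- S) <= m z.
  move=> z0 zt t1; apply: harnack; first by rewrite t1 (le_trans z0).
    by rewrite distrC; exact: USd.
  by rewrite -lerN2; exact: nd.
have [yx|/ltW xy] := leP y x; first by apply: fin1; exact: dn.
by apply: (fin (m 1)); [rewrite -m01|]; apply: dn.
Qed.

Lemma powR_strongly_monotone (k M a b : R) : 0 < k -> k <= a <= M -> k <= b <= M ->
  q * k `^ q / M * (a - b) ^+ 2 <= (a `^ q - b `^ q) * (a - b).
Proof.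
move=> k0; wlog ab : a b / b <= a => [wl|] ka kb.
  have [ba|/ltW ab] := leP b a; first exact: wl.
  by have := wl b a ab kb ka; rewrite -sqrrN opprB => /le_trans; apply; lra.
have [ka1 aM] := andP ka; have [kb1 bM] := andP kb.
have b0 : 0 < b by exact: lt_le_trans kb1.
have a0 : 0 < a by exact: lt_le_trans ka1.
have M0 : 0 < M by exact: lt_le_trans aM.
pose s := ln a - ln b.
have aE : a = b * expR s by rewrite expRB !lnK ?posrE// mulrC divfK// gt_eqF.
have aqE : a `^ q = b `^ q * expR (q * s).
  by rewrite aE powRM ?expR_ge0 ?ltW// [q * s]mulrC expRM.
have bE : expR (- s) = b / a by rewrite expRN aE; field; rewrite !gt_eqF ?expR_gt0.
have e1 := expR_ge1Dx (- s); have e2 := expR_ge1Dx (q * s).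
have sge : (a - b) / M <= s.
  apply: (@le_trans _ _ ((a - b) / a)).
    by rewrite ler_wpM2l ?subr_ge0// lef_pV2 ?posrE.
  by rewrite mulrBl divff ?gt_eqF// -bE; lra.
have kbq : k `^ q <= b `^ q by rewrite ge0_ler_powR ?nnegrE ?(ltW q_gt0) ?(ltW k0) ?(ltW b0).
rewrite expr2 mulrA ler_wpM2r ?subr_ge0//.
have -> : a `^ q - b `^ q = b `^ q * (expR (q * s) - 1) by rewrite aqE; ring.
apply: (@le_trans _ _ (b `^ q * (q * s))); last first.
  by rewrite ler_wpM2l ?powR_ge0//; lra.
have -> : q * k `^ q / M * (a - b) = k `^ q * (q * ((a - b) / M)) by ring.
have abM : 0 <= (a - b) / M by rewrite divr_ge0 ?subr_ge0// ltW.
apply: ler_pM => //; first exact: powR_ge0.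
  by rewrite mulr_ge0// ltW.
by rewrite ler_wpM2l// ltW.
Qed.

End UniformBounds.

(** * Dependence on the parameter *)

Section Dependence.
Context {R : realType}.
Context (q : R) (q_gt0 : 0 < q).
Local Notation I := (@torus_integral R).
Context (v : R -> R) (V : R) (V_gt0 : 0 < V).
Context (v_bd : forall y : R, 0 <= y <= 1 -> 0 <= v y <= V).

(** The squared form is the one that integrates against [sqr_torus_integral_le].
The bound itself is the tangent inequality of [t^(q+1)], i.e. Young. *)
Lemma powRS_lipschitz (M a b : R) : 0 <= a <= M -> 0 <= b <= M ->
  (a `^ q * a - b `^ q * b) ^+ 2 <= ((q + 1) * M `^ q) ^+ 2 * (a - b) ^+ 2.
Proof.
wlog ab : a b / b <= a => [wl|] aM bM.
  have [ba|/ltW ab] := leP b a; first exact: wl.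
  by rewrite -sqrrN opprB -[in leRHS](sqrrN (a - b)) opprB; exact: wl.
have [a0 aM1] := andP aM; have [b0 bM1] := andP bM.
have y1 := young_le q_gt0 a0 b0; have y2 := young_le q_gt0 b0 a0.
have nb := powR_ge0 b q; have na := powR_ge0 a q.
have aMq : a `^ q <= M `^ q.
  by apply: ge0_ler_powR; rewrite ?nnegrE ?(ltW q_gt0)// (le_trans a0).
have k0 : 0 <= (q + 1) * M `^ q * (a - b).
  by rewrite !mulr_ge0 ?powR_ge0 ?subr_ge0//; have := q_gt0; lra.
rewrite -exprMn ler_sqr ?nnegrE//.
  have : (q + 1) * (a `^ q * (a - b)) <= (q + 1) * (M `^ q * (a - b)).
    apply: ler_wpM2l; first by have := q_gt0; lra.
    by apply: ler_wpM2r; rewrite ?subr_ge0.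
  by lra.
have : b `^ q * b <= a `^ q * a.
  by apply: ler_pM => //; apply: ge0_ler_powR; rewrite ?nnegrE ?(ltW q_gt0).
by lra.
Qed.

(** Let [X] and [Y] be the squared L^2 norms of [p1 - p2] and [m1 - m2].
[cross_sum] bounds [X + Y] by a multiple of [db * dP], and since
[db] is the integral of [m1 p1 - m2 p2], also [db^2] by a multiple of [X + Y];
dividing by [db] gives the first estimate.  The second follows from [Y]. *)
Lemma flux_lipschitz (B : R) : exists A L : R,
  0 <= A /\ 0 <= L /\
  forall P1 P2 c1 c2 p1 p2 m1 m2, `|P1| <= B -> `|P2| <= B ->
    classical q v P1 c1 p1 m1 -> classical q v P2 c2 p2 m2 ->
    `|flux p1 m1 - flux p2 m2| <= A * `|P1 - P2| /\
    `|coupling_energy q m1 - coupling_energy q m2| <= L * `|P1 - P2|.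
Proof.
pose M := 2 + 2 * V; pose S := B + B ^+ 2 + 4 * V + 2 * M `^ q.
pose k := expR (- (2 * S)); have k0 : 0 < k by exact: expR_gt0.
pose kap := q * k `^ q / M.
have M0 : 0 < M by rewrite addr_gt0// mulr_gt0.
have kap0 : 0 < kap by rewrite divr_gt0// mulr_gt0// powR_gt0.
(* [k X + kap Y] is the quantity below [db * dP]; [A] is the cost of bounding
   [2 M^2 X + 2 S^2 Y] by it. *)
pose A := 2 * M ^+ 2 / k + 2 * S ^+ 2 / kap.
have A0 : 0 <= A.
  by rewrite addr_ge0// divr_ge0 ?(ltW k0) ?(ltW kap0)// mulr_ge0// sqr_ge0.
pose D := (q + 1) * M `^ q.
have D0 : 0 <= D by rewrite mulr_ge0 ?powR_ge0// addr_ge0// ltW.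
pose L := D * (1 + A / kap).
have Ak0 : 0 <= A / kap by rewrite divr_ge0// ltW.
exists A, L; split => //; split; first by rewrite mulr_ge0// addr_ge0.
move=> P1 P2 c1 c2 p1 p2 m1 m2 P1B P2B s1 s2.
have S1 := gradient_bound q_gt0 V_gt0 v_bd P1B s1.
have S2 := gradient_bound q_gt0 V_gt0 v_bd P2B s2.
have l1 := density_lower_bound s1 S1; have l2 := density_lower_bound s2 S2.
have u1 := density_bound q_gt0 V_gt0 v_bd s1.
have u2 := density_bound q_gt0 V_gt0 v_bd s2.
rewrite -/M -/S in S1 S2 l1 l2 u1 u2; rewrite -/k in l1 l2.
have cq1 := classical_C0_powR q_gt0 s1; have cq2 := classical_C0_powR q_gt0 s2.
have := cross_sum q_gt0 s1 s2.
have -> : I (fun y => (v y - v y) * (m1 y - m2 y)) = 0.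
  by rewrite -[RHS](torus_integral_cst 0); apply: eq_torus_integral => y _; ring.
rewrite addr0.
case: s1 => cv cp1 cm1 m10 _ _ _ _ _ _; case: s2 => _ cp2 cm2 m20 _ _ _ _ _ _.
set db := flux p1 m1 - flux p2 m2; set dP := P1 - P2 => csum.
pose X := I (fun y => (p1 y - p2 y) ^+ 2); pose Y := I (fun y => (m1 y - m2 y) ^+ 2).
have Xle : k * X <= 2^-1 * I (fun y => (m1 y + m2 y) * (p1 y - p2 y) ^+ 2).
  rewrite -!torus_integralZ; [|c0..]; apply: le_torus_integral; [c0|c0|] => y y01.
  have : k * (p1 y - p2 y) ^+ 2 <= (2^-1 * (m1 y + m2 y)) * (p1 y - p2 y) ^+ 2.
    by rewrite ler_wpM2r ?sqr_ge0//; have := l1 _ y01; have := l2 _ y01; lra.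
  by lra.
have Yle : kap * Y <= I (fun y => (m1 y `^ q - m2 y `^ q) * (m1 y - m2 y)).
  rewrite -torus_integralZ; [|c0]; apply: le_torus_integral; [c0|c0|] => y y01.
  by apply: powR_strongly_monotone => //; rewrite ?l1 ?l2 ?u1 ?u2.
have X0 : 0 <= X by apply: torus_integral_ge0 => y _; exact: sqr_ge0.
have Y0 : 0 <= Y by apply: torus_integral_ge0 => y _; exact: sqr_ge0.
have dbI : db = I (fun y => m1 y * p1 y - m2 y * p2 y) by rewrite torus_integralB//; c0.
have dbXY : db ^+ 2 <= A * (k * X + kap * Y).
  rewrite dbI; apply: (@le_trans _ _ (I (fun y => (m1 y * p1 y - m2 y * p2 y) ^+ 2))).
    by apply: sqr_torus_integral_le; c0.
  apply: (@le_trans _ _ (2 * M ^+ 2 * X + 2 * S ^+ 2 * Y)).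
    rewrite -!torus_integralZ; [|c0..]; rewrite -torus_integralD; [|c0..].
    apply: le_torus_integral; [c0|c0|] => y y01.
    have h1 : m1 y ^+ 2 * (p1 y - p2 y) ^+ 2 <= M ^+ 2 * (p1 y - p2 y) ^+ 2.
      by rewrite ler_wpM2r ?sqr_ge0// lerXn2r ?nnegrE ?m10 ?u1// ltW.
    have h2 : p2 y ^+ 2 * (m1 y - m2 y) ^+ 2 <= S ^+ 2 * (m1 y - m2 y) ^+ 2.
      rewrite ler_wpM2r ?sqr_ge0// -[p2 y ^+ 2]real_normK ?num_real//.
      by rewrite lerXn2r ?nnegrE ?S2// (le_trans _ (S2 _ y01)).
    have := sqr_ge0 (m1 y * (p1 y - p2 y) - p2 y * (m1 y - m2 y)).
    by lra.
  have e1 : 2 * M ^+ 2 * X = 2 * M ^+ 2 / k * (k * X).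
    by rewrite mulrA divfK// gt_eqF.
  have e2 : 2 * S ^+ 2 * Y = 2 * S ^+ 2 / kap * (kap * Y).
    by rewrite mulrA divfK// gt_eqF.
  have -> : A * (k * X + kap * Y) = 2 * M ^+ 2 / k * (k * X + kap * Y) +
      2 * S ^+ 2 / kap * (k * X + kap * Y) by rewrite /A; ring.
  rewrite e1 e2; apply: lerD; apply: ler_wpM2l.
  - by rewrite divr_ge0 ?(ltW k0)// mulr_ge0// sqr_ge0.
  - by rewrite lerDl mulr_ge0// ltW.
  - by rewrite divr_ge0 ?(ltW kap0)// mulr_ge0// sqr_ge0.
  - by rewrite lerDr mulr_ge0// ltW.
have dbP : `|db| <= A * `|dP|.
  have [->|db0] := eqVneq db 0; first by rewrite normr0 mulr_ge0.
  have ndb0 : 0 < `|db| by rewrite normr_gt0.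
  rewrite -(ler_pM2l ndb0) -expr2 real_normK ?num_real//; apply: (le_trans dbXY).
  apply: (@le_trans _ _ (A * (db * dP))); first by apply: ler_wpM2l => //; lra.
  rewrite [leRHS]mulrCA -normrM ler_wpM2l//; exact: ler_norm.
split => //.
have YP : kap * Y <= A * dP ^+ 2.
  have kX0 : 0 <= k * X by rewrite mulr_ge0// ltW.
  have : db * dP <= A * dP ^+ 2; last by lra.
  apply: le_trans (ler_norm _) _; rewrite normrM.
  by rewrite -[dP ^+ 2]real_normK ?num_real// expr2 mulrA ler_wpM2r.
have dGI : coupling_energy q m1 - coupling_energy q m2 =
    I (fun y => m1 y `^ q * m1 y - m2 y `^ q * m2 y) by rewrite torus_integralB//; c0.
have dG2 : (coupling_energy q m1 - coupling_energy q m2) ^+ 2 <= D ^+ 2 * Y.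
  rewrite dGI; apply: (@le_trans _ _ (I (fun y => (m1 y `^ q * m1 y - m2 y `^ q * m2 y) ^+ 2))).
    by apply: sqr_torus_integral_le; c0.
  rewrite -torus_integralZ; [|c0]; apply: le_torus_integral; [c0|c0|] => y y01.
  by apply: powRS_lipschitz; rewrite ?m10 ?m20 ?u1 ?u2.
have YP' : Y <= A / kap * dP ^+ 2.
  rewrite -(ler_pM2l kap0); have -> // : kap * (A / kap * dP ^+ 2) = A * dP ^+ 2.
  by rewrite mulrA [kap * _]mulrC divfK// gt_eqF.
have LP0 : 0 <= L * `|dP| by rewrite mulr_ge0// mulr_ge0// addr_ge0.
rewrite -(ler_sqr (normr_ge0 _)) ?nnegrE// real_normK ?num_real//.
apply: (le_trans dG2); rewrite [leRHS]exprMn real_normK ?num_real//.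
have -> : L ^+ 2 * dP ^+ 2 = D ^+ 2 * ((1 + A / kap) ^+ 2 * dP ^+ 2).
  by rewrite [RHS]mulrA; congr (_ * _); exact: exprMn.
apply: ler_wpM2l; first exact: sqr_ge0.
apply: le_trans YP' _; apply: ler_wpM2r; first exact: sqr_ge0.
by have := sqr_ge0 (A / kap); lra.
Qed.

(** In [cross_identity] the quadratic term is nonnegative, and Young's inequality
[(q+1) m2 m1^q <= q m1^(q+1) + m2^(q+1)] absorbs the coupling term into the
difference of the energies. *)
Lemma corrected_subgradient P1 P2 c1 c2 p1 p2 m1 m2 :
  classical q v P1 c1 p1 m1 -> classical q v P2 c2 p2 m2 ->
  flux p2 m2 * (P1 - P2) <=
    (c1 + q / (q + 1) * coupling_energy q m1) - (c2 + q / (q + 1) * coupling_energy q m2).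
Proof.
move=> s1 s2; have cq1 := classical_C0_powR q_gt0 s1.
have cq2 := classical_C0_powR q_gt0 s2.
have := cross_identity q_gt0 s1 s2.
have -> : I (fun y => (v y - v y) * m2 y) = 0.
  by rewrite -[RHS](torus_integral_cst 0); apply: eq_torus_integral => y _; ring.
case: s1 => cv cp1 cm1 m10 _ _ _ _ _ _; case: s2 => _ cp2 cm2 m20 _ _ _ _ _ _.
have X0 : 0 <= I (fun y => m2 y * (p1 y - p2 y) ^+ 2).
  by apply: torus_integral_ge0 => y /m20 my; rewrite mulr_ge0// sqr_ge0.
set b := flux p2 m2.
have q1 : 0 < q + 1 by rewrite addr_gt0.
have : (q + 1) * I (fun y => (m1 y `^ q - m2 y `^ q) * m2 y) <=
    q * (coupling_energy q m1 - coupling_energy q m2).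
  rewrite /coupling_energy -torus_integralB; [|c0..]; rewrite -!torus_integralZ; [|c0..].
  apply: le_torus_integral; [c0|c0|] => y y01.
  by have := young_le q_gt0 (m10 _ y01) (m20 _ y01); lra.
rewrite mulrC -ler_pdivlMr// => h e.
have : q * (coupling_energy q m1 - coupling_energy q m2) / (q + 1) =
   q / (q + 1) * coupling_energy q m1 - q / (q + 1) * coupling_energy q m2 by ring.
by lra.
Qed.

Lemma coupling_energy_ge1 P c p m : classical q v P c p m ->
  1 <= coupling_energy q m.
Proof.
move=> s; have cq := classical_C0_powR q_gt0 s.
case: s => cv cp cm m0 _ _ _ Im _ _.
have : 0 <= I (fun y => q + m y `^ q * m y - (q + 1) * m y).
  apply: torus_integral_ge0 => y y01; have := young_le q_gt0 ler01 (m0 _ y01).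
  by rewrite powR1; lra.
rewrite torus_integralB; [|c0..];
  rewrite torus_integralD; [|c0..];
  rewrite torus_integralZ; [|c0].
by rewrite torus_integral_cst Im -/(coupling_energy q m); lra.
Qed.

(** The Young deficit between [m] and 1 is nonnegative with integral 0, so it
vanishes pointwise and [m = 1].  The derivatives of [m] and then of [p] vanish,
which makes both equations algebraic. *)
Lemma coupling_energy_eq1 P c p m : classical q v P c p m ->
  coupling_energy q m = 1 -> exists d, forall y, 0 < y < 1 -> v y = d.
Proof.
move=> s; have cq := classical_C0_powR q_gt0 s.
have PB : `|P| <= `|P| by [].
have S1 := gradient_bound q_gt0 V_gt0 v_bd PB s.
have l1 := density_lower_bound s S1.
case: s => cv cp cm m0 _ _ _ Im dp dm G1.
pose f y := q + m y `^ q * m y - (q + 1) * m y.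
have f0 y : 0 <= y <= 1 -> 0 <= f y.
  move=> y01; have := young_le q_gt0 ler01 (m0 _ y01).
  by rewrite powR1 /f; lra.
have If : I f = 0.
  rewrite torus_integralB; [|c0..];
    rewrite torus_integralD; [|c0..];
    rewrite torus_integralZ; [|c0].
  by rewrite torus_integral_cst Im -/(coupling_energy q m) G1; lra.
have cf : C0 f by rewrite /f; c0.
have m1 y : 0 < y < 1 -> m y = 1.
  move=> y01; have := torus_integral_eq0 cf f0 If y01; rewrite /f => fy.
  have y01' : 0 <= y <= 1 by have /andP[? ?] := y01; rewrite !ltW.
  have my0 : 0 < m y by apply: lt_le_trans (l1 _ y01'); exact: expR_gt0.
  apply/eqP/negPn/negP => my1; rewrite eq_sym in my1.
  by have := young_lt q_gt0 ltr01 my0 my1; rewrite powR1; lra.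
set b := I _ in dm.
have pb y : 0 < y < 1 -> p y = b.
  move=> y01; have d1 : is_derive y 1 (fun=> 1 : R) (b - m y * p y).
    by apply: near_eq_is_derive (dm _ y01); near=> z; apply: m1; near: z; exact: near_oo.
  have := @derive_val _ _ _ _ _ _ _ d1; rewrite derive_cst (m1 y)//.
  by lra.
exists (b ^+ 2 / 2 - 1 - c) => y y01.
have d2 : is_derive y 1 (fun=> b : R) (p y ^+ 2 / 2 - v y - m y `^ q - c).
  by apply: near_eq_is_derive (dp _ y01); near=> z; apply: pb; near: z; exact: near_oo.
have := @derive_val _ _ _ _ _ _ _ d2; rewrite derive_cst (m1 y)// (pb y)// powR1.
by lra.
Unshelve. all: by end_near. Qed.

(** Testing the equation of [m] with [m - 1] gives
[P W = - I (m (m - 1) (p - P))], where [W] is the variance of [m]; the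
right-hand side is bounded uniformly in [P], so [W] is of order [1 / P], and
it controls the excess of the energy over 1. *)
Lemma coupling_energy_cvg1 (eta : R) : 0 < eta -> exists P0 : R, forall P c p m,
  P0 <= P -> classical q v P c p m -> coupling_energy q m <= 1 + eta.
Proof.
move=> eta0; pose M := 2 + 2 * V.
have M0 : 0 < M by rewrite addr_gt0// mulr_gt0.
pose C1 := M ^+ 2 * (M + 1) ^+ 2 + V.
have C10 : 0 < C1 by rewrite ltr_wpDl// mulr_ge0 ?sqr_ge0.
pose A := M `^ q + 1.
have A0 : 0 < A by rewrite ltr_wpDl// powR_ge0.
pose e1 := eta / (2 * (q + 1)).
have q1 : 0 < q + 1 by rewrite addr_gt0.
have e10 : 0 < e1 by rewrite divr_gt0// mulr_gt0.
pose k := A ^+ 2 / (4 * e1).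
have k0 : 0 < k by rewrite divr_gt0 ?exprn_gt0// mulr_gt0.
exists (k * C1 / e1) => P c p m P0P s.
have P0 : 0 < P by apply: lt_le_trans P0P; rewrite divr_gt0// mulr_gt0.
have mM := density_bound q_gt0 V_gt0 v_bd s; rewrite -/M in mM.
have [ep _] := energy_bound q_gt0 v_bd s.
have cq := classical_C0_powR q_gt0 s.
case: s => cv cp cm m0 p01 m01 Ip Im dp dm.
set b := I _ in dm.
pose W := I (fun y => (m y - 1) ^+ 2).
have PW : P * W <= C1.
  have dw (y : R) : 0 < y < 1 -> is_derive y 1 (fun y => 2^-1 * (m y - 1) ^+ 2)
      ((m y - 1) * (b - m y * p y)).
    move=> y01; have ? := dm _ y01.
    by apply: is_derive_eq; rewrite /GRing.scale /=; field.
  have Iw0 : I (fun y => (m y - 1) * (b - m y * p y)) = 0.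
    by rewrite (torus_integral_deriv _ _ dw); [rewrite m01 subrr|c0..].
  have : I (fun y => (b - P) * (m y - 1) - m y * (m y - 1) * (p y - P) - P * (m y - 1) ^+ 2) = 0.
    by rewrite -Iw0; apply: eq_torus_integral => y _; ring.
  rewrite torus_integralB; [|c0..];
    rewrite torus_integralB; [|c0..];
    rewrite !torus_integralZ; [|c0..].
  rewrite torus_integralB; [|c0..]; rewrite Im torus_integral_cst subrr mulr0 => e.
  have : - I (fun y => m y * (m y - 1) * (p y - P)) <=
      2^-1 * (M ^+ 2 * (M + 1) ^+ 2) + 2^-1 * I (fun y => (p y - P) ^+ 2).
    have -> : 2^-1 * (M ^+ 2 * (M + 1) ^+ 2) + 2^-1 * I (fun y => (p y - P) ^+ 2) =
        I (fun y => 2^-1 * (M ^+ 2 * (M + 1) ^+ 2) + 2^-1 * (p y - P) ^+ 2).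
      by rewrite torus_integralD; [|c0..];
        rewrite torus_integral_cst torus_integralZ; [|c0].
    have -> : - I (fun y => m y * (m y - 1) * (p y - P)) =
        I (fun y => -1 * (m y * (m y - 1) * (p y - P))) by rewrite torus_integralZ ?mulN1r//; c0.
    apply: le_torus_integral; [c0|c0|] => y y01; have my0 := m0 _ y01; have myM := mM _ y01.
    have h1 : (m y * (m y - 1)) ^+ 2 <= M ^+ 2 * (M + 1) ^+ 2.
      rewrite exprMn; apply: ler_pM; rewrite ?sqr_ge0//.
        by rewrite lerXn2r ?nnegrE// ltW.
      by rewrite -[(m y - 1) ^+ 2]real_normK ?num_real// lerXn2r ?nnegrE//;
        [rewrite addr_ge0// ltW|rewrite ler_norml; apply/andP; split; lra].
    have := sqr_ge0 (m y * (m y - 1) + (p y - P)); lra.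
  have : 0 <= M ^+ 2 * (M + 1) ^+ 2 by rewrite mulr_ge0 ?sqr_ge0.
  by rewrite /C1 -/W in e *; lra.
have kW : k * W <= e1.
  rewrite -(ler_pM2r P0); apply: (@le_trans _ _ (k * C1)).
    by rewrite -mulrA ler_wpM2l ?(ltW k0)// mulrC.
  by rewrite [e1 * P]mulrC -ler_pdivrMr.
have G1 : coupling_energy q m - 1 <= (q + 1) * I (fun y => (m y `^ q - 1) * (m y - 1)).
  have -> : coupling_energy q m - 1 = I (fun y => m y `^ q * m y - 1 - (q + 1) * (m y - 1)).
    rewrite torus_integralB; [|c0..];
      rewrite torus_integralB; [|c0..];
      rewrite torus_integralZ; [|c0].
    by rewrite torus_integralB; [|c0..];
      rewrite !torus_integral_cst Im /coupling_energy; ring.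
  rewrite -torus_integralZ; [|c0]; apply: le_torus_integral; [c0|c0|] => y y01.
  by have := young_le q_gt0 (m0 _ y01) ler01; rewrite powR1; lra.
have G2 : I (fun y => (m y `^ q - 1) * (m y - 1)) <= e1 + k * W.
  have -> : e1 + k * W = I (fun y => e1 + k * (m y - 1) ^+ 2).
    by rewrite torus_integralD; [|c0..];
      rewrite torus_integral_cst torus_integralZ; [|c0].
  apply: le_torus_integral; [c0|c0|] => y y01; have my0 := m0 _ y01; have myM := mM _ y01.
  have mq0 := powR_ge0 (m y) q.
  have mqM : m y `^ q <= M `^ q.
    by apply: ge0_ler_powR; rewrite ?nnegrE ?(ltW q_gt0) ?(ltW M0).
  have h : (m y `^ q - 1) ^+ 2 <= A ^+ 2.
    rewrite -[leLHS]real_normK ?num_real// lerXn2r ?nnegrE ?(ltW A0)//.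
    by rewrite ler_norml /A; apply/andP; split; lra.
  have h2 : (m y `^ q - 1) ^+ 2 * (m y - 1) ^+ 2 <= A ^+ 2 * (m y - 1) ^+ 2.
    by rewrite ler_wpM2r// sqr_ge0.
  have e14 : 0 < 4 * e1 by rewrite mulr_gt0.
  have kE : 4 * e1 * k = A ^+ 2 by rewrite /k mulrC divfK// gt_eqF.
  rewrite -(ler_pM2l e14).
  have -> : 4 * e1 * (e1 + k * (m y - 1) ^+ 2) = 4 * e1 ^+ 2 + A ^+ 2 * (m y - 1) ^+ 2.
    by rewrite -kE; ring.
  by have := sqr_ge0 (2 * e1 - (m y `^ q - 1) * (m y - 1)); lra.
have : (q + 1) * I (fun y => (m y `^ q - 1) * (m y - 1)) <= (q + 1) * (e1 + e1).
  by apply: ler_wpM2l; lra.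
have -> : (q + 1) * (e1 + e1) = eta by rewrite /e1; field; rewrite gt_eqF.
by lra.
Qed.

End Dependence.

(** * Lipschitz functions with vanishing derivative *)

Section LipschitzDensity.
Context {R : realType}.
Local Notation lambda := (@lebesgue_measure R).

Lemma stieltjes_ocitv (F : cumulative R R) (a b : R) : a <= b ->
  lebesgue_stieltjes_measure F `]a, b] = (F b - F a)%:E.
Proof.
move=> ab; rewrite /lebesgue_stieltjes_measure /measure_extension.
by rewrite measurable_mu_extE/= ?wlength_itv_bnd//; exact: is_ocitv.
Qed.

(** The Stieltjes measures of [F] and [F'] add up to [K] times the Lebesgue
measure, because they do so on half-open intervals. *)
Lemma lipschitz_stieltjes_dominated (K : R) (K0 : 0 <= K) (F F' : cumulative R R) :
  (forall x, F x + F' x = K * x) ->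
  lebesgue_stieltjes_measure F `<< lambda.
Proof.
move=> FF'; apply/null_content_dominatesP => A mA A0.
pose S := measure_add (lebesgue_stieltjes_measure F)
                      (lebesgue_stieltjes_measure F').
have id_nd : nondecreasing (fun x : R => K * x).
  by move=> x y xy; exact: ler_wpM2l.
have id_rc : right_continuous (fun x : R => K * x).
  by apply: right_continuousW => x; apply: cvgM; [exact: cvg_cst|exact: cvg_id].
pose cK := isCumulative.Build R _ R _ id_nd id_rc.
pose KI : cumulative R R := HB.pack (fun x : R => K * x) cK.
have SE : lebesgue_stieltjes_measure KI A = S A.
  apply: lebesgue_stieltjes_measure_unique => // X.
  move=> /ocitvP[->|[[x y] /= xy ->]]; first by rewrite !measure0.
  transitivity ((F y - F x)%:E + (F' y - F' x)%:E)%E.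
    rewrite (stieltjes_ocitv KI (ltW xy)) /= -EFinD; congr EFin.
    by have := FF' x; have := FF' y; lra.
  rewrite [RHS]measure_addE.
  by congr (_ + _)%E; apply/esym; exact: stieltjes_ocitv (ltW xy).
have LE : lebesgue_stieltjes_measure KI A = mscale (NngNum K0) lambda A.
  apply: lebesgue_stieltjes_measure_unique => // X.
  move=> /ocitvP[->|[[x y] /= xy ->]]; first by rewrite !measure0.
  rewrite /= /mscale stieltjes_ocitv ?(ltW xy)//= lebesgue_measure_itv /= lte_fin xy.
  by rewrite -EFinB -EFinM; congr EFin; ring.
apply/eqP; rewrite eq_le measure_ge0 andbT.
have <- : S A = 0%E by rewrite -SE LE /= /mscale A0 mule0.
by rewrite /S measure_addE leeDl.
Qed.

(** Normalizing [F] as a distribution function makes its Stieltjes measure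
finite, as the Radon-Nikodym theorem requires.  [K x - F x] is nondecreasing
too, which gives absolute continuity. *)
Lemma lipschitz_cdf_density (K : R) (F : R -> R) :
  (forall x y, x <= y -> 0 <= F y - F x <= K * (y - x)) ->
  F @ -oo --> (0 : R) -> F @ +oo --> (1 : R) ->
  exists f : R -> R, lambda.-integrable setT (EFin \o f) /\
    forall x y, x <= y -> F y - F x = \int[lambda]_(t in `]x, y]) f t.
Proof.
move=> FK F0 F1.
have K0 : 0 <= K.
  by have /andP[] := FK 0 1 ler01; rewrite subr0 mulr1; exact: le_trans.
have F_nd : nondecreasing F by move=> x y /FK/andP[+ _]; rewrite subr_ge0.
have F_cont : continuous F.
  move=> x; apply/cvgrPdist_le => e e0.
  have k1 : 0 < K + 1 by rewrite ltr_wpDl.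
  near=> y.
  have xy : `|x - y| <= e / (K + 1).
    near: y; apply: filterS (nbhsx_ballx x _ (divr_gt0 e0 k1)) => y.
    exact: ltW.
  apply: (@le_trans _ _ ((K + 1) * `|x - y|)); last first.
    by rewrite mulrC -ler_pdivlMr.
  apply: (@le_trans _ _ (K * `|x - y|)); last by rewrite ler_wpM2r// lerDl.
  have [xley|/ltW ylex] := leP x y.
    by rewrite distrC ger0_norm ?(andP (FK _ _ xley)).1// distrC ger0_norm
      ?subr_ge0// (andP (FK _ _ xley)).2.
  by rewrite ger0_norm ?(andP (FK _ _ ylex)).1// ger0_norm
      ?subr_ge0// (andP (FK _ _ ylex)).2.
pose cF := isCumulative.Build R _ R F F_nd (right_continuousW F_cont).
pose bF := isCumulativeBounded.Build R 0 1 F F0 F1.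
pose FF : cumulativeBounded (0 : R) (1 : R) := HB.pack F cF bF.
pose F' x := K * x - F x.
have F'_nd : nondecreasing F'.
  by move=> x y /FK/andP[_]; rewrite /F'; lra.
have F'_cont : continuous F'.
  move=> x; apply: cvgB; last exact: F_cont.
  by apply: cvgM; [exact: cvg_cst|exact: cvg_id].
pose cF' := isCumulative.Build R _ R F' F'_nd (right_continuousW F'_cont).
pose FF' : cumulative R R := HB.pack F' cF'.
have dom : lebesgue_stieltjes_measure FF `<< lambda.
  apply: (@lipschitz_stieltjes_dominated K K0 FF FF') => x /=.
  by rewrite /F' addrC subrK.
have [f [f0 ffin fint fE]] := radon_nikodym_sigma_finite dom.
have fE' : EFin \o (fine \o f) = f by apply/funext => x /=; rewrite fineK.
exists (fine \o f); split; first by rewrite fE'.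
move=> x y xy; rewrite /Rintegral.
have -> : (\int[lambda]_(t in `]x, y]) ((fine \o f) t)%:E =
           \int[lambda]_(t in `]x, y]) f t)%E.
  by apply: eq_integral => t _ /=; rewrite fineK.
rewrite -fE; last exact: measurable_itv.
transitivity (fine (F y - F x)%:E) => //; congr fine; apply/esym.
exact: (stieltjes_ocitv FF xy).
Unshelve. all: by end_near. Qed.

(** [G], extended by constants outside [a, b] and tilted by a slope exceeding its
Lipschitz constant, becomes an increasing function with a Lebesgue density.
By Lebesgue differentiation the density is almost everywhere the derivative,
which is the tilt alone; integrating it back shows that [G] contributes
nothing. *)
Lemma lipschitz_derive0_cst (G : R -> R) (a b L : R) : a < b ->
  (forall x y, a <= x -> x <= y -> y <= b -> `|G y - G x| <= L * (y - x)) ->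
  (forall x, a < x < b -> derivable G x 1 -> derive1 G x = 0) ->
  G a = G b.
Proof.
move=> ab GL G'0.
have L0 : 0 <= L.
  have := GL a b (lexx a) (ltW ab) (lexx b) => /(le_trans (normr_ge0 _)).
  by rewrite pmulr_lge0// subr_gt0.
pose cl x := Num.max a (Num.min x b).
have cl_bd x : a <= cl x <= b.
  by rewrite le_max lexx ge_max (ltW ab) ge_min lexx orbT.
have cl_nd x y : x <= y -> 0 <= cl y - cl x <= y - x.
  move=> xy; rewrite /cl.
  case: (leP x b) => xb; case: (leP y b) => yb; rewrite ?(max_r (ltW ab));
    case: (leP a x) => ax; case: (leP a y) => ay; lra.
(* The slope [L + 1], and not [L], keeps the total increase [D] positive. *)
pose F0 x := G (cl x) + (L + 1) * cl x.
have F0K x y : x <= y ->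
    cl y - cl x <= F0 y - F0 x <= (2 * L + 1) * (y - x).
  move=> xy; have /andP[c1 c2] := cl_nd _ _ xy.
  have /andP[a1 b1] := cl_bd x; have /andP[a2 b2] := cl_bd y.
  have : `|G (cl y) - G (cl x)| <= L * (cl y - cl x) by apply: GL; lra.
  rewrite ler_norml => /andP[g1 g2].
  have : (2 * L + 1) * (cl y - cl x) <= (2 * L + 1) * (y - x).
    by apply: ler_wpM2l; lra.
  by rewrite /F0; lra.
have clL x : x <= a -> cl x = a.
  by move=> xa; rewrite /cl; case: (leP x b) => ?; rewrite ?(max_r (ltW ab));
    case: (leP a x) => ?; lra.
have clR x : b <= x -> cl x = b.
  by move=> xb; rewrite /cl; case: (leP x b) => ?; rewrite ?(max_r (ltW ab));
    case: (leP a x) => ?; lra.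
have clM x : a <= x <= b -> cl x = x.
  by move=> /andP[ax xb]; rewrite /cl; case: (leP x b) => ?; rewrite ?(max_r (ltW ab));
    case: (leP a x) => ?; lra.
pose D := F0 b - F0 a.
have D0 : 0 < D.
  have /andP[+ _] := F0K _ _ (ltW ab); rewrite (clL a)// (clR b)//.
  by rewrite /D; apply: lt_le_trans; rewrite subr_gt0.
pose F x := (F0 x - F0 a) / D.
have FK x y : x <= y -> 0 <= F y - F x <= (2 * L + 1) / D * (y - x).
  move=> xy; have /andP[f1 f2] := F0K _ _ xy; have /andP[c1 _] := cl_nd _ _ xy.
  rewrite (_ : F y - F x = (F0 y - F0 x) / D); last by rewrite /F; ring.
  apply/andP; split.
    by apply: divr_ge0; [exact: le_trans f1|exact: ltW].
  by rewrite mulrAC ler_pM2r// invr_gt0.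
have FN : F @ -oo --> (0 : R).
  apply: (cvg_near_cst (0 : R)).
  apply: filterS (nbhs_ninfty_le (num_real a)) => x xa.
  by rewrite /F /F0 (clL x)// (clL a)// subrr mul0r.
have FP : F @ +oo --> (1 : R).
  apply: (cvg_near_cst (1 : R)).
  apply: filterS (nbhs_pinfty_ge (num_real b)) => x bx.
  by rewrite /F /F0 (clR x)// -[in LHS](clR b)// -/(F0 b) -/(D) divff// gt_eqF.
have [f [intf fE]] := lipschitz_cdf_density FK FN FP.
have Fa : F a = 0 by rewrite /F subrr mul0r.
have Fb : F b = 1 by rewrite /F -/D divff// gt_eqF.
have intfA (A : set R) : measurable A -> lambda.-integrable A (EFin \o f).
  by move=> mA; apply: integrableS intf.
have locf : locally_integrable [set: R] f.
  have := integrable_locally measurableT intf.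
  by rewrite (_ : f \_ setT = f)//; apply/funext => x; rewrite patchE in_setT.
have aeF := FTC1 (a := BRight a) (fun y => intfA _ (measurable_itv _)) locf.
have aef : ae_eq lambda `]a, b[%classic (EFin \o f) (fun=> ((L + 1) / D)%:E).
  move: aeF; apply: filterS; first exact: (ae_filter_ringOfSetsType lambda).
  move=> x /= + xab; move: xab; rewrite in_itv /= => /andP[ax xb].
  rewrite lte_fin => /(_ ax); set Phi := (X in derivable X x 1) => -[dPhi Phi'].
  have dPhiF : is_derive x 1 Phi (f x).
    by rewrite -Phi' derive1E; apply/derivableP.
  have dlin : is_derive x 1 (fun z : R => D * Phi z + (F0 a - (L + 1) * z))
                (D *: f x + (0 - (L + 1) *: 1)).
    apply: is_deriveD; apply: is_deriveB.
  have dG : is_derive x 1 G (D *: f x + (0 - (L + 1) *: 1)).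
    apply: near_eq_is_derive dlin; near=> z.
    have zab : a < z < b.
      by near: z; apply: near_oo; rewrite ax.
    have /andP[az zb] := zab.
    rewrite /Phi -fE ?(ltW az)// Fa subr0 /F /F0 (clM z) ?(clM a); [|lra..].
    by field; rewrite gt_eqF.
  have dG1 : derivable G x 1 by exact: ex_derive.
  have DfL : D * f x + (0 - (L + 1) * 1) = 0.
    have xab : a < x < b by rewrite ax.
    by have := G'0 x xab dG1; rewrite derive1E derive_val.
  congr EFin; rewrite -[f x](mulKf (lt0r_neq0 D0)).
  by rewrite (_ : D * f x = L + 1) 1?mulrC//; lra.
have : F b - F a = (L + 1) / D * (b - a).
  rewrite fE ?(ltW ab)// -Rintegral_itv_bndo_bndc; last exact: intfA.
  rewrite /Rintegral (ae_eq_integral (fun=> ((L + 1) / D)%:E))//.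
  - rewrite integral_cst//= lebesgue_measure_itv/= lte_fin ab.
    by rewrite -EFinB -EFinM.
  - by have /integrableP[] := intfA _ (measurable_itv `]a, b[).
rewrite Fa Fb subr0 => /(congr1 ( *%R D)).
rewrite mulr1 mulrA mulrCA divff ?gt_eqF// mulr1 {1}/D /F0.
by rewrite (clM a) ?(clM b) ?lexx ?(ltW ab)//; lra.
Unshelve. all: by end_near. Qed.

End LipschitzDensity.

(** * Conclusion *)

Section Final.
Context {R : realType}.

Lemma is_derive_quadratic (f : R -> R) (x l C : R) :
  (forall y, `|y - x| <= 1 -> `|f y - f x - l * (y - x)| <= C * (y - x) ^+ 2) ->
  is_derive x 1 f l.
Proof.
move=> fC; have C1 : 0 < `|C| + 1 by rewrite ltr_wpDl.
have cvgf : h^-1 *: ((f \o shift x) (h *: (1 : R)) - f x) @[h --> 0^'] --> l.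
  apply/cvgrPdist_le => e e0.
  have d0 : 0 < Num.min 1 (e / (`|C| + 1)) by rewrite lt_min ltr01 divr_gt0.
  exists (Num.min 1 (e / (`|C| + 1))) => //= h /=.
  rewrite sub0r normrN lt_min => /andP[/ltW h1 /ltW he] h0.
  have -> : h *: (1 : R) + x = x + h by rewrite /GRing.scale /= mulr1 addrC.
  have := fC (x + h); rewrite addrAC subrr add0r => /(_ h1) fh.
  rewrite distrC -(ler_pM2l (_ : 0 < `|h|)) ?normr_gt0// -normrM.
  rewrite /GRing.scale /= mulrBr mulrA divff// mul1r [h * l]mulrC.
  apply: (le_trans fh); rewrite -[h ^+ 2]real_normK ?num_real// expr2 mulrCA.
  rewrite ler_wpM2l//; apply: (@le_trans _ _ ((`|C| + 1) * `|h|)).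
    by rewrite ler_wpM2r//; have := ler_norm C; lra.
  by rewrite mulrC -ler_pdivlMr.
split; first by apply/cvg_ex; exists l.
exact: (cvg_lim _ cvgf).
Qed.

Lemma periodic_const (v : R -> R) (k d : R) : periodic v 1 ->
  (forall x y, `|v x - v y| <= k * `|x - y|) ->
  (forall y : R, 0 < y < 1 -> v y = d) -> forall y, v y = d.
Proof.
move=> vper vlip vd.
have v0 : v 0 = d.
  apply/eqP; rewrite -subr_eq0 -normr_eq0 eq_le normr_ge0 andbT.
  have k1 : 0 < `|k| + 1 by rewrite ltr_wpDl.
  apply/ler_addgt0Pl => e e0; rewrite addr0.
  pose y := Num.min (2^-1) (e / (`|k| + 1)).
  have y0 : 0 < y by rewrite lt_min invr_gt0 ltr0n divr_gt0.
  have y1 : y < 1 by rewrite gt_min; apply/orP; left; lra.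
  rewrite -(vd y) ?y0//; apply: le_trans (vlip _ _) _.
  rewrite sub0r normrN (gtr0_norm y0).
  apply: (@le_trans _ _ ((`|k| + 1) * y)).
    by rewrite ler_wpM2r ?(ltW y0)//; have := ler_norm k; lra.
  by rewrite mulrC -ler_pdivlMr// ge_min lexx orbT.
have vn (n : nat) x : v (x + n%:R) = v x.
  elim: n => [|n ih]; first by rewrite addr0.
  by rewrite -natr1 addrA vper.
have vz (n : int) x : v (x + n%:~R) = v x.
  case: n => n; first exact: vn.
  by rewrite NegzE mulrNz -[LHS](vn n.+1) subrK.
move=> y; have /andP[f0 f1] := floor_itv y.
rewrite -(vz (- Num.floor y)) mulrNz.
have : 0 <= y - (Num.floor y)%:~R < 1 by move: f0 f1; rewrite intrD /=; lra.
move=> /andP[]; rewrite le_eqVlt => /predU1P[<- _ //|z0 z1].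
by apply: vd; rewrite z0.
Qed.

End Final.

Theorem corollary2p3 (R : realType) (q : R) (v : R -> R)
    (Hbar bbar : R -> R -> R)
    (q_gt0 : 0 < q)
    (v_per : periodic v 1)
    (v_lip : exists k : R, k.-lipschitz v)
    (v_ge0 : forall y : R, 0 <= v y)
    (v_nonconst : ~ exists c : R, forall y, v y = c)
    (HbarP : effective_hamiltonian q v Hbar)
    (bbarP : effective_drift q v Hbar bbar) :
  exists P alpha : R,
    [/\ 0 <= alpha,
        derivable (fun P' : R => Hbar P' alpha) P 1 &
        derive1 (fun P' : R => Hbar P' alpha) P <> bbar P alpha].
Proof.
have [k vlip] : exists k : R, forall x y, `|v x - v y| <= k * `|x - y|.
  by have [k vk] := v_lip; exists k => x y; exact: (vk (x, y)).
have cv : continuous v.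
  apply: (@hoelder_continuous _ _ k 1) => // x y.
  by rewrite powRr1.
have [V V_gt0 v_bd] : exists2 V : R, 0 < V & forall y : R, 0 <= y <= 1 -> 0 <= v y <= V.
  have [x _ vx] := EVT_max ler01 (C0_continuous cv).
  exists (v x + 1) => [|y y01]; first by rewrite ltr_wpDl.
  by rewrite v_ge0 (le_trans (vx y _)) ?in_itv// lerDl.
have sol P : exists pm : (R -> R) * (R -> R),
    classical q v P (Hbar P 1) pm.1 pm.2 /\ bbar P 1 = flux pm.1 pm.2.
  have [_ /(_ erefl)[u [m um]]] := HbarP P 1 ler01 (Hbar P 1).
  exists (fun y => derive1 u y + P, m); split; first exact: classical_of_cell um.
  by rewrite (bbarP P 1 ler01 _ _ um); apply: eq_torus_integral => y _; rewrite mulrC.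
have [s sP] := choice sol.
pose G P := coupling_energy q (s P).2.
pose kap := q / (q + 1).
have kap0 : kap != 0 by rewrite gt_eqF// divr_gt0// addr_gt0.
have Lip (B : R) : exists A L : R, 0 <= A /\ 0 <= L /\ forall P1 P2, `|P1| <= B -> `|P2| <= B ->
    `|bbar P1 1 - bbar P2 1| <= A * `|P1 - P2| /\ `|G P1 - G P2| <= L * `|P1 - P2|.
  have [A [L [A0 [L0 AL]]]] := flux_lipschitz q_gt0 V_gt0 v_bd B.
  exists A, L; split => //; split => // P1 P2 P1B P2B.
  have [s1 ->] := sP P1; have [s2 ->] := sP P2; exact: AL P1B P2B s1 s2.
pose K P := Hbar P 1 + kap * G P.
have Ksub (P1 P2 : R) : bbar P2 1 * (P1 - P2) <= K P1 - K P2.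
  have [s1 _] := sP P1; have [s2 ->] := sP P2.
  by have := corrected_subgradient q_gt0 s1 s2.
have dK (P : R) : is_derive P 1 K (bbar P 1).
  have [A [L [A0 [_ AL]]]] := Lip (`|P| + 1).
  apply: (@is_derive_quadratic _ _ _ _ A) => P' PP'.
  have P'B : `|P'| <= `|P| + 1.
    by have := ler_normD (P' - P) P; rewrite subrK; lra.
  have PB : `|P| <= `|P| + 1 by rewrite lerDl.
  have [bA _] := AL _ _ P'B PB.
  have k1 := Ksub P' P; have k2 := Ksub P P'.
  rewrite ger0_norm ?subr_ge0//.
  apply: (@le_trans _ _ ((bbar P' 1 - bbar P 1) * (P' - P))); first by lra.
  apply: le_trans (ler_norm _) _; rewrite normrM.
  rewrite -[(P' - P) ^+ 2]real_normK ?num_real// expr2 mulrA.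
  by rewrite ler_wpM2r.
apply/not_existsP => no.
have G'0 (P : R) : derivable G P 1 -> derive1 G P = 0.
  move=> dG; have dGd : is_derive P 1 G (derive1 G P).
    by rewrite derive1E; exact/derivableP.
  have dH : is_derive P 1 (fun P' => Hbar P' 1) (bbar P 1 - kap * derive1 G P).
    rewrite (_ : (fun P' => _) = fun P' => K P' - kap * G P').
      by apply: is_derive_eq.
    by apply/funext => P'; rewrite /K addrK.
  have H'b : derive1 (fun P' => Hbar P' 1) P = bbar P 1.
    apply: contra_notP (no P) => H'b; exists 1.
    by split; [exact: ler01|case: dH|exact: H'b].
  move: H'b; rewrite derive1E derive_val => /eqP.
  by rewrite -subr_eq0 addrAC subrr add0r oppr_eq0 mulf_eq0 (negbTE kap0) => /eqP.
have Gcst (a b : R) : a < b -> G a = G b.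
  move=> ab; have [A [L [_ [L0 AL]]]] := Lip (`|a| + `|b|).
  apply: (@lipschitz_derive0_cst _ _ _ _ L) => // [x y ax xy yb|x _]; last exact: G'0.
  have bd z : a <= z -> z <= b -> `|z| <= `|a| + `|b|.
    move=> az zb; have := ler_norm (- a); have := ler_norm b; rewrite normrN => nb na.
    have := normr_ge0 a; have := normr_ge0 b.
    by rewrite ler_norml => *; apply/andP; split; lra.
  have [_] := AL y x (bd _ (le_trans ax xy) yb) (bd _ ax (le_trans xy yb)).
  by rewrite [`|y - x|]ger0_norm ?subr_ge0.
have [s0 _] := sP 0.
have G0 : G 0 = 1.
  apply/eqP; rewrite eq_le (coupling_energy_ge1 q_gt0 s0) andbT.
  apply/ler_addgt0Pr => e e0.
  have [P0 limG] := coupling_energy_cvg1 q_gt0 V_gt0 v_bd e0.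
  rewrite (Gcst 0 (`|P0| + 1)); last by rewrite ltr_wpDl.
  have [sP0 _] := sP (`|P0| + 1); apply: limG sP0.
  by apply: le_trans (ler_norm _) _; rewrite lerDl.
have [d vd] := coupling_energy_eq1 q_gt0 V_gt0 v_bd s0 G0.
by apply: v_nonconst; exists d; exact: periodic_const v_per vlip vd.
Qed.
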